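(* $$\sum_{k=1}^\infty\frac{S_1(2k)+17S_1(k)}{k^2\binom{2k}{k}}=\frac52\sqrt3\,\pi K.$$
   Context: $S_1(n):=\sum_{i=1}^n \frac1i$ is the $n$-th harmonic number. $K:=2c_1-\frac{4\pi^2}{27}+2$, where $c_1:=\sum_{i=1}^\infty\frac{1}{(1+3i)^2}$. *)

(* Defs.v *)
From Stdlib Require Import Reals.
From Coquelicot Require Import Coquelicot.
Open Scope R_scope.

Definition S1 (n : nat) : R := sum_n_m (fun i : nat => 1 / INR i) 1 n.

(* [Series] starts at index 0, hence the shift by [S i]. *)
Definition c1 : R := Series (fun i : nat => 1 / (1 + 3 * INR (S i)) ^ 2).

Definition K : R := 2 * c1 - 4 * PI ^ 2 / 27 + 2.

(* [Binomial.C] is qualified because Coquelicot's [C] is the type of complex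
   numbers. *)
Definition summand (k : nat) : R :=
  (S1 (2 * k) + 17 * S1 k) / (INR k ^ 2 * Binomial.C (2 * k) k).

(* Main.v *)
Require Import Defs.
From Stdlib Require Import Reals Lra Lia PSeries_reg Ranalysis5.
From Coquelicot Require Import Coquelicot.
Open Scope R_scope.

(** Put [coef k = 1 / ((k+1)^2 binom(2k+2, k+1))], [a = PI / 6], and write [C2], [C3]
    for the sums of [sin (n x) / n^2] and [cos (n x) / n^3], which are [Fsin 1 2] and
    [Fcos 1 3].

    The harmonic numbers are produced by integration.  The integral over [0, 1] of
    [(1 - w^(2k)) (1 + 35 w) / (1 - w^2)] is [S1 (2k) + 17 S1 k], so the series of the
    theorem is the value at [w = 1] of [harm_series], whose derivative is
    [(F 1 - F w) (1 + 35 w) / (1 - w^2)] with [F w] the sum of [coef k * w^(2k+2)].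
    With [w = 2 sin t] one has [F w = 2 t^2] ([arcsin_sq_eq]), because the second
    derivatives in [t] of the terms telescope to [4].  Integration by parts then leaves
    the log-sine integral
      [- 4 * int_0^a t (18 ln (1 - 2 sin t) + 17 ln (1 + 2 sin t)) dt];
    here it appears as a function of [t] that is constant on [0, a)
    ([conserved_const]) and whose limit at [a] is taken in [harm_series_1].

    Both logarithms split into logarithms of [2 sin (x / 2)] with
    [x = 5 a - t, a - t, a + t, 5 a + t], and [C2' x = - ln (2 sin (x / 2))]
    ([Fsin_2_derive]), [C3' = - C2], so the integrand has an explicit primitive.  Its
    values at [0] and [a] involve [C2] and [C3] at multiples of [a].  The duplication
    formulas ([Fcos_dup], [Fsin_dup]) and [Fcos_3_third] reduce the [C3] part to
    [C3 0], with total coefficient zero: the weights 1 and 17 are in the proportion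
    for which zeta(3) cancels.  They reduce the [C2] values to [C2 (2 PI / 3)], which is
    [sqrt 3 / 2 * K] ([Fsin_2_third]): splitting by residues mod 3 gives the sum of
    [1 / (3j+1)^2 - 1 / (3j+2)^2], and the Basel sum ([basel]) turns it into [K].

    Termwise differentiation of [C2] and of the sum of [cos (n x) / n^2] gives only
    conditionally convergent series.  Abel means avoid them: the Fourier series damped by
    [r^n] have elementary closed forms, which converge locally uniformly on (0, PI) as
    [r] tends to 1. *)

(** * Termwise calculus for series of functions *)

(** The Coquelicot operations are turned into those of [R], so that [ring] and [field]
    recognise them. *)
Ltac R_ops :=
  repeat match goal with
    | |- context [@plus ?G ?a ?b] => change (@plus G a b) with (a + b)
    | |- context [@scal ?F ?V ?a ?b] => change (@scal F V a b) with (a * b)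
    end;
  match goal with |- ?a = ?b => change (@eq R a b) end.

Lemma Series_zero (f : nat -> R) : (forall n, f n = 0) -> Series f = 0.
Proof.
  intros Hf; rewrite (Series_ext _ (fun _ => 0 * 0)) by (intros n; rewrite Hf; ring).
  rewrite Series_scal_l; ring.
Qed.

Lemma ex_series_dom (a M : nat -> R) :
  (forall n, Rabs (a n) <= M n) -> ex_series M -> ex_series a.
Proof.
  intros H HM.
  exact (ex_series_le (K := R_AbsRing) (V := R_CompleteNormedModule) a M H HM).
Qed.

Lemma Series_tail_le (a M : nat -> R) (N : nat) :
  (forall n, Rabs (a n) <= M n) -> ex_series M ->
  Rabs (Series a - sum_n a N) <= Series M - sum_n M N.
Proof.
  intros H HM.
  assert (Ha := ex_series_dom a M H HM).
  rewrite (Series_incr_n a (S N)) by (lia || assumption).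
  rewrite (Series_incr_n M (S N)) by (lia || assumption).
  rewrite !sum_n_Reals; simpl Nat.pred.
  match goal with |- Rabs (?u + ?v - ?u) <= ?x + ?y - ?x =>
    replace (u + v - u) with v by ring; replace (x + y - x) with y by ring end.
  assert (HM' := proj1 (ex_series_incr_n M (S N)) HM).
  eapply Rle_trans.
  - apply Series_Rabs.
    apply ex_series_dom with (2 := HM').
    intros n; rewrite Rabs_Rabsolu; apply H.
  - apply Series_le; [|exact HM'].
    intros n; split; [apply Rabs_pos | apply H].
Qed.

Lemma Series_remainder_0 (M : nat -> R) :
  ex_series M -> is_lim_seq (fun N => Series M - sum_n M N) 0.
Proof.
  intros HM.
  replace 0 with (Series M - Series M) by ring.
  apply is_lim_seq_minus'; [apply is_lim_seq_const | exact (Series_correct M HM)].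
Qed.

Lemma ball_in_interval (a b x : R) :
  a < x < b -> exists r : posreal, forall y, Boule x r y -> a < y < b.
Proof.
  intros Hx.
  assert (Hr : 0 < Rmin (x - a) (b - x)) by (apply Rmin_pos; lra).
  exists (mkposreal _ Hr); unfold Boule; simpl; intros y Hy.
  apply Rabs_def2 in Hy.
  generalize (Rmin_l (x - a) (b - x)) (Rmin_r (x - a) (b - x)); lra.
Qed.

Lemma CVU_of_bound (fn : nat -> R -> R) (f : R -> R) (e : nat -> R)
  (x : R) (r : posreal) :
  (forall n y, Boule x r y -> Rabs (fn n y - f y) <= e n) ->
  is_lim_seq e 0 -> CVU fn f x r.
Proof.
  intros H He eps Heps.
  apply is_lim_seq_Reals in He.
  destruct (He eps Heps) as [N HN].
  exists N; intros n y Hn Hy.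
  specialize (HN n Hn); unfold Rdist in HN.
  rewrite Rminus_0_r in HN.
  rewrite Rabs_minus_sym.
  eapply Rle_lt_trans; [apply H, Hy|].
  eapply Rle_lt_trans; [apply Rle_abs | exact HN].
Qed.

(** The interchange of limit and derivative, with uniform convergence of the derivatives
    expressed by an explicit error [e n]; it serves both for series and for Abel
    limits. *)
Lemma is_derive_limit (fn fn' : nat -> R -> R) (f g : R -> R) (e : nat -> R)
  (a b x : R) :
  a < x < b ->
  (forall n y, a < y < b -> is_derive (fn n) y (fn' n y)) ->
  (forall y, a < y < b -> is_lim_seq (fun n => fn n y) (f y)) ->
  (forall n y, a < y < b -> Rabs (fn' n y - g y) <= e n) ->
  is_lim_seq e 0 ->
  (forall y, a < y < b -> continuous g y) ->
  is_derive f x (g x).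
Proof.
  intros Hx Hd Hl Hb He Hc.
  destruct (ball_in_interval a b x Hx) as [r Hr].
  apply is_derive_Reals.
  apply derivable_pt_lim_CVU with (fn := fn) (fn' := fn') (c := x) (r := r).
  - unfold Boule; rewrite Rminus_diag, Rabs_R0; apply cond_pos.
  - intros y n Hy; apply is_derive_Reals, Hd, Hr, Hy.
  - intros y Hy; apply is_lim_seq_Reals, Hl, Hr, Hy.
  - apply CVU_of_bound with (e := e); [|exact He].
    intros n y Hy; apply Hb, Hr, Hy.
  - intros y Hy; apply continuity_pt_filterlim, Hc, Hr, Hy.
Qed.

Lemma continuous_sum_n (f : nat -> R -> R) (x : R) (N : nat) :
  (forall n, continuous (f n) x) -> continuous (fun y => sum_n (fun n => f n y) N) x.
Proof.
  intros H; induction N as [|N IH].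
  - eapply continuous_ext; [|apply (H 0%nat)].
    intros y; now rewrite sum_O.
  - apply (continuous_ext (fun y => plus (sum_n (fun n => f n y) N) (f (S N) y))).
    + intros y; now rewrite sum_Sn.
    + apply (continuous_plus (K := R_AbsRing) (V := R_NormedModule)); auto.
Qed.

Lemma continuous_Series (f : nat -> R -> R) (M : nat -> R) (a b x : R) :
  a < x < b ->
  (forall n y, a < y < b -> continuous (f n) y) ->
  (forall n y, a < y < b -> Rabs (f n y) <= M n) -> ex_series M ->
  continuous (fun y => Series (fun n => f n y)) x.
Proof.
  intros Hx Hc Hb HM.
  destruct (ball_in_interval a b x Hx) as [r Hr].
  apply continuity_pt_filterlim.
  apply CVU_continuity with (fn := fun N y => sum_n (fun n => f n y) N) (x := x) (r := r).
  - apply CVU_of_bound with (e := fun N => Series M - sum_n M N).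
    + intros N y Hy; rewrite Rabs_minus_sym.
      apply (Series_tail_le (fun n => f n y)); [|exact HM].
      intros n; apply Hb, Hr, Hy.
    + apply Series_remainder_0, HM.
  - intros N y Hy; apply continuity_pt_filterlim.
    apply (continuous_sum_n f); intros n; apply Hc, Hr, Hy.
  - unfold Boule; rewrite Rminus_diag, Rabs_R0; apply cond_pos.
Qed.

Lemma is_derive_Series (f g : nat -> R -> R) (M : nat -> R) (a b x : R) :
  a < x < b ->
  (forall n y, a < y < b -> is_derive (f n) y (g n y)) ->
  (forall n y, a < y < b -> continuous (g n) y) ->
  (forall n y, a < y < b -> Rabs (g n y) <= M n) -> ex_series M ->
  (forall y, a < y < b -> ex_series (fun n => f n y)) ->
  is_derive (fun y => Series (fun n => f n y)) x (Series (fun n => g n x)).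
Proof.
  intros Hx Hd Hc Hb HM Hs.
  apply (is_derive_limit (fun N y => sum_n (fun n => f n y) N)
          (fun N y => sum_n (fun n => g n y) N) (fun y => Series (fun n => f n y))
          (fun y => Series (fun n => g n y)) (fun N => Series M - sum_n M N) a b);
    [exact Hx | | | | |].
  - intros N y Hy; apply (is_derive_sum_n f); intros k _; apply Hd, Hy.
  - intros y Hy; apply (Series_correct _ (Hs y Hy)).
  - intros N y Hy; rewrite Rabs_minus_sym.
    apply (Series_tail_le (fun n => g n y)); [|exact HM].
    intros n; apply Hb, Hy.
  - apply Series_remainder_0, HM.
  - intros y Hy; apply (continuous_Series g M a b); assumption.
Qed.

Lemma eq_of_derive_0 (h : R -> R) (a b : R) :
  a < b ->
  (forall x, a < x < b -> is_derive h x 0) ->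
  (forall x, a <= x <= b -> continuous h x) -> h a = h b.
Proof.
  intros Hab Hd Hc.
  destruct (MVT_gen h a b (fun _ => 0)) as [c [_ Hh]].
  - rewrite Rmin_left, Rmax_right by lra; exact Hd.
  - rewrite Rmin_left, Rmax_right by lra.
    intros x Hx; apply continuity_pt_filterlim, Hc, Hx.
  - lra.
Qed.

Lemma continuous_of_is_derive (f : R -> R) (x l : R) :
  is_derive f x l -> continuous f x.
Proof. intros H; apply (ex_derive_continuous (V := R_NormedModule)); exists l; exact H. Qed.

(** Blocks have length [S m]. *)
Lemma sum_n_block (a : nat -> R) (m N : nat) :
  sum_n (fun j => sum_n (fun i => a (S m * j + i)%nat) m) N
  = sum_n a (S m * N + m).
Proof.
  induction N as [|N IH].
  - rewrite sum_O, Nat.mul_0_r; apply sum_n_ext; intros i; f_equal; lia.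
  - rewrite sum_Sn, IH.
    assert (E : forall p, plus (sum_n a (S m * N + m)) (sum_n (fun i => a (S m * S N + i)%nat) p)
                = sum_n a (S m * S N + p)).
    { induction p as [|p IHp].
      - rewrite sum_O; replace (S m * S N + 0)%nat with (S (S m * N + m)) by lia.
        now rewrite sum_Sn.
      - rewrite sum_Sn, plus_assoc, IHp.
        replace (S m * S N + S p)%nat with (S (S m * S N + p)) by lia.
        now rewrite sum_Sn. }
    apply E.
Qed.

Lemma is_series_block (a : nat -> R) (m : nat) (l : R) :
  is_series a l -> is_series (fun j => sum_n (fun i => a (S m * j + i)%nat) m) l.
Proof.
  intros H.
  change (is_lim_seq (sum_n (fun j => sum_n (fun i => a (S m * j + i)%nat) m)) l).
  apply (is_lim_seq_ext (fun N => sum_n a (S m * N + m))).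
  - intros N; symmetry; apply sum_n_block.
  - apply (is_lim_seq_subseq (sum_n a)); [|exact H].
    apply eventually_subseq; intros n; lia.
Qed.

(** * Damped Fourier series *)

Definition weight (r : R) (s n : nat) : R := r ^ S n / INR (S n) ^ s.
Definition summable (r : R) (s : nat) : Prop := ex_series (fun n => Rabs (weight r s n)).
(** The sums run over [n >= 1], whence the shift.  For [r = 1] they are Clausen-type
    functions, and [r < 1] gives their Abel means. *)
Definition Fcos (r : R) (s : nat) (x : R) : R :=
  Series (fun n => weight r s n * cos (INR (S n) * x)).
Definition Fsin (r : R) (s : nat) (x : R) : R :=
  Series (fun n => weight r s n * sin (INR (S n) * x)).

Lemma INR_S_pos (n : nat) : 0 < INR (S n).
Proof. apply lt_0_INR; lia. Qed.

Lemma Rabs_pow_le_1 (r : R) (n : nat) : Rabs r <= 1 -> Rabs (r ^ n) <= 1.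
Proof.
  intros H; rewrite <- RPow_abs, <- (pow1 n).
  apply pow_incr; split; [apply Rabs_pos | exact H].
Qed.

Lemma Rabs_weight (r : R) (s n : nat) : Rabs (weight r s n) = Rabs r ^ S n / INR (S n) ^ s.
Proof.
  unfold weight; rewrite Rabs_div.
  - rewrite RPow_abs; f_equal; apply Rabs_right, Rle_ge, pow_le, pos_INR.
  - apply pow_nonzero, Rgt_not_eq, INR_S_pos.
Qed.

Lemma inv_S_lim : is_lim_seq (fun n => / INR (S n)) 0.
Proof.
  apply (proj1 (is_lim_seq_incr_1 (fun n => / INR n) 0)).
  replace (Finite 0) with (Rbar_inv p_infty) by reflexivity.
  apply is_lim_seq_inv; [apply is_lim_seq_INR | discriminate].
Qed.

(** Comparison with the telescoping series of [2 / (n (n + 1))]. *)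
Lemma ex_series_inv_sq : ex_series (fun n => / INR (S n) ^ 2).
Proof.
  assert (H : is_series (fun n => 2 * (/ INR (S n) - / INR (S (S n)))) 2).
  { change (is_lim_seq (sum_n (fun n => 2 * (/ INR (S n) - / INR (S (S n))))) 2).
    apply (is_lim_seq_ext (fun n => 2 - 2 * / INR (S (S n)))).
    - intros N; induction N as [|N IH].
      + rewrite sum_O; simpl; field.
      + rewrite sum_Sn, <- IH.
        R_ops; ring.
    - replace (Finite 2) with (Finite (2 - 2 * 0)) by (f_equal; ring).
      apply is_lim_seq_minus'; [apply is_lim_seq_const|].
      apply is_lim_seq_mult'; [apply is_lim_seq_const|].
      apply (proj1 (is_lim_seq_incr_1 (fun n => / INR (S n)) 0)), inv_S_lim. }
  eapply ex_series_dom; [|exists 2; exact H].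
  intros n; cbv beta.
  assert (P := INR_S_pos n); rewrite (S_INR (S n)).
  rewrite Rabs_right by (apply Rle_ge, Rlt_le, Rinv_0_lt_compat, pow_lt, P).
  replace (2 * (/ INR (S n) - / (INR (S n) + 1)))
    with (/ (INR (S n) * (INR (S n) + 1) / 2)) by (field; lra).
  apply Rinv_le_contravar; [|assert (1 <= INR (S n)) by (apply (le_INR 1); lia); nra].
  nra.
Qed.

Lemma summable_sq (r : R) (s : nat) : Rabs r <= 1 -> (2 <= s)%nat -> summable r s.
Proof.
  intros Hr Hs.
  apply ex_series_dom with (2 := ex_series_inv_sq).
  intros n; rewrite Rabs_Rabsolu, Rabs_weight.
  assert (P := INR_S_pos n).
  assert (P1 : 1 <= INR (S n)) by (apply (le_INR 1); lia).
  assert (H1 : Rabs r ^ S n <= 1) by (rewrite RPow_abs; apply Rabs_pow_le_1, Hr).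
  assert (H2 : INR (S n) ^ 2 <= INR (S n) ^ s) by (apply Rle_pow; assumption).
  assert (P2 := pow_lt _ 2 P).
  rewrite <- (Rmult_1_l (/ INR (S n) ^ 2)).
  apply Rmult_le_compat; [apply pow_le, Rabs_pos | | exact H1 |].
  - left; apply Rinv_0_lt_compat, pow_lt, P.
  - apply Rinv_le_contravar; assumption.
Qed.

Lemma summable_lt1 (r : R) (s : nat) : Rabs r < 1 -> summable r s.
Proof.
  intros Hr.
  apply ex_series_dom with (M := fun n => Rabs r ^ n).
  2: apply ex_series_geom; now rewrite Rabs_Rabsolu.
  intros n; rewrite Rabs_Rabsolu, Rabs_weight.
  assert (P1 : 1 <= INR (S n)) by (apply (le_INR 1); lia).
  assert (P := Rabs_pos r).
  assert (H := pow_le _ n P).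
  assert (H2 : 1 <= INR (S n) ^ s) by (apply pow_R1_Rle, P1).
  apply Rle_div_l; [lra|].
  change (Rabs r ^ S n) with (Rabs r * Rabs r ^ n).
  apply Rle_trans with (Rabs r ^ n * 1); [|apply Rmult_le_compat_l; assumption].
  rewrite Rmult_comm; apply Rmult_le_compat_l; lra.
Qed.

Lemma weight_succ (r : R) (s n : nat) : weight r (S s) n * INR (S n) = weight r s n.
Proof.
  unfold weight; generalize (INR_S_pos n); generalize (INR (S n)) (r ^ S n); intros k q P.
  simpl pow; field; split; [apply pow_nonzero|]; lra.
Qed.

Lemma Rabs_mult_le_1 (c x : R) : Rabs x <= 1 -> Rabs (c * x) <= Rabs c.
Proof.
  intros H; rewrite Rabs_mult; assert (P := Rabs_pos c); nra.
Qed.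

Lemma Rabs_cos_le (x : R) : Rabs (cos x) <= 1.
Proof. apply Rabs_le, COS_bound. Qed.

Lemma Rabs_sin_le (x : R) : Rabs (sin x) <= 1.
Proof. apply Rabs_le, SIN_bound. Qed.

Lemma Fcos_ex (r : R) (s : nat) (x : R) : summable r s ->
  ex_series (fun n => weight r s n * cos (INR (S n) * x)).
Proof.
  intros H; apply ex_series_dom with (2 := H).
  intros n; apply Rabs_mult_le_1, Rabs_cos_le.
Qed.

Lemma Fsin_ex (r : R) (s : nat) (x : R) : summable r s ->
  ex_series (fun n => weight r s n * sin (INR (S n) * x)).
Proof.
  intros H; apply ex_series_dom with (2 := H).
  intros n; apply Rabs_mult_le_1, Rabs_sin_le.
Qed.

Lemma summable_succ (r : R) (s : nat) : summable r s -> summable r (S s).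
Proof.
  intros H; apply ex_series_dom with (2 := H).
  intros n; rewrite Rabs_Rabsolu, <- (weight_succ r s n), Rabs_mult.
  assert (P1 : 1 <= INR (S n)) by (apply (le_INR 1); lia).
  rewrite (Rabs_right (INR _)) by lra.
  assert (P := Rabs_pos (weight r (S s) n)); nra.
Qed.

Lemma Fcos_derive (r : R) (s : nat) (x : R) : summable r s ->
  is_derive (Fcos r (S s)) x (- Fsin r s x).
Proof.
  intros H.
  replace (- Fsin r s x)
    with (Series (fun n => - (weight r s n * sin (INR (S n) * x)))) by apply Series_opp.
  apply (is_derive_Series (fun n y => weight r (S s) n * cos (INR (S n) * y))
    (fun n y => - (weight r s n * sin (INR (S n) * y)))
    (fun n => Rabs (weight r s n)) (x - 1) (x + 1)); [lra | | | | exact H |].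
  - intros n y _; rewrite <- (weight_succ r s n).
    generalize (weight r (S s) n) (INR (S n)); intros; auto_derive; [easy|ring].
  - intros n y _; apply (ex_derive_continuous (V := R_NormedModule)).
    generalize (weight r s n) (INR (S n)); intros; auto_derive; easy.
  - intros n y _; rewrite Rabs_Ropp; apply Rabs_mult_le_1, Rabs_sin_le.
  - intros y _; apply Fcos_ex, summable_succ, H.
Qed.

Lemma Fsin_derive (r : R) (s : nat) (x : R) : summable r s ->
  is_derive (Fsin r (S s)) x (Fcos r s x).
Proof.
  intros H.
  apply (is_derive_Series (fun n y => weight r (S s) n * sin (INR (S n) * y))
    (fun n y => weight r s n * cos (INR (S n) * y))
    (fun n => Rabs (weight r s n)) (x - 1) (x + 1)); [lra | | | | exact H |].
  - intros n y _; rewrite <- (weight_succ r s n).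
    generalize (weight r (S s) n) (INR (S n)); intros; auto_derive; [easy|ring].
  - intros n y _; apply (ex_derive_continuous (V := R_NormedModule)).
    generalize (weight r s n) (INR (S n)); intros; auto_derive; easy.
  - intros n y _; apply Rabs_mult_le_1, Rabs_cos_le.
  - intros y _; apply Fsin_ex, summable_succ, H.
Qed.

Lemma Fsin_continuous (s : nat) (x : R) : (2 <= s)%nat -> continuous (Fsin 1 s) x.
Proof.
  intros Hs.
  assert (H1 : Rabs 1 <= 1) by (rewrite Rabs_R1; lra).
  apply (continuous_Series (fun n y => weight 1 s n * sin (INR (S n) * y))
    (fun n => Rabs (weight 1 s n)) (x - 1) (x + 1)); [lra | | |].
  - intros n y _; apply (ex_derive_continuous (V := R_NormedModule)).
    generalize (weight 1 s n) (INR (S n)); intros; auto_derive; easy.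
  - intros n y _; apply Rabs_mult_le_1, Rabs_sin_le.
  - apply summable_sq; assumption.
Qed.

Lemma Fcos_continuous (s : nat) (x : R) : (2 <= s)%nat -> continuous (Fcos 1 s) x.
Proof.
  intros Hs.
  assert (H1 : Rabs 1 <= 1) by (rewrite Rabs_R1; lra).
  apply (continuous_Series (fun n y => weight 1 s n * cos (INR (S n) * y))
    (fun n => Rabs (weight 1 s n)) (x - 1) (x + 1)); [lra | | |].
  - intros n y _; apply (ex_derive_continuous (V := R_NormedModule)).
    generalize (weight 1 s n) (INR (S n)); intros; auto_derive; easy.
  - intros n y _; apply Rabs_mult_le_1, Rabs_cos_le.
  - apply summable_sq; assumption.
Qed.

(** A radius that is smooth in [t] on both sides of [0] and never exceeds 1, so that the
    limit [r -> 1] becomes continuity at the interior point [t = 0]. *)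
Definition abel_radius (t : R) : R := / (1 + t ^ 2).

Lemma abel_radius_bounds (t : R) : 0 < abel_radius t <= 1.
Proof.
  unfold abel_radius; assert (0 <= t ^ 2) by apply pow2_ge_0.
  split; [apply Rinv_0_lt_compat; lra|].
  rewrite <- Rinv_1; apply Rinv_le_contravar; lra.
Qed.

Lemma abel_radius_lt1 (t : R) : 0 < t -> 0 < abel_radius t < 1.
Proof.
  intros Ht; unfold abel_radius; assert (0 < t ^ 2) by now apply pow_lt.
  split; [apply Rinv_0_lt_compat; lra|].
  rewrite <- Rinv_1 at 2; apply Rinv_lt_contravar; lra.
Qed.

Lemma Series_abel_lim (s : nat) (u : nat -> R) : (2 <= s)%nat ->
  (forall n, Rabs (u n) <= 1) ->
  is_lim_seq (fun n => Series (fun k => weight (abel_radius (/ INR (S n))) s k * u k))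
    (Series (fun k => weight 1 s k * u k)).
Proof.
  intros Hs Hu.
  assert (R0 : abel_radius 0 = 1) by (unfold abel_radius; field).
  assert (C : continuous (fun t => Series (fun k => weight (abel_radius t) s k * u k)) 0).
  { apply (continuous_Series (fun k t => weight (abel_radius t) s k * u k)
      (fun n => Rabs (weight 1 s n)) (-1) 1); [lra | | |].
    - intros n y _; apply (ex_derive_continuous (V := R_NormedModule)).
      unfold weight, abel_radius; generalize (u n) (INR (S n) ^ s); intros.
      auto_derive; nra.
    - intros n y _; eapply Rle_trans; [apply Rabs_mult_le_1, Hu|].
      rewrite !Rabs_weight, Rabs_R1, pow1.
      assert (Q : 0 < INR (S n) ^ s) by apply pow_lt, INR_S_pos.
      apply Rmult_le_compat_r; [left; apply Rinv_0_lt_compat, Q|].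
      rewrite RPow_abs; apply Rabs_pow_le_1.
      generalize (abel_radius_bounds y); intros; rewrite Rabs_right; lra.
    - apply summable_sq; [rewrite Rabs_R1; lra | exact Hs]. }
  rewrite <- R0.
  apply (is_lim_seq_continuous (fun t => Series (fun k => weight (abel_radius t) s k * u k))
    (fun n => / INR (S n)) 0); [apply continuity_pt_filterlim, C|].
  exact inv_S_lim.
Qed.

(** * The logarithmic and linear Fourier sums *)

Lemma poisson_den_pos (r x : R) : Rabs r < 1 -> 0 < 1 - 2 * r * cos x + r ^ 2.
Proof.
  intros H; apply Rabs_def2 in H; generalize (COS_bound x); intros Hc.
  destruct (Rle_dec 0 r); nra.
Qed.

(** The recurrence [cos (n+2)x = 2 cos x cos (n+1)x - cos nx] makes the partial sums
    telescope after multiplication by the denominator. *)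
Lemma is_series_geom_cos (r x : R) : Rabs r < 1 ->
  is_series (fun n => r ^ n * cos (INR (S n) * x))
    ((cos x - r) / (1 - 2 * r * cos x + r ^ 2)).
Proof.
  intros H; assert (D := poisson_den_pos r x H).
  set (d := 1 - 2 * r * cos x + r ^ 2) in *.
  change (is_lim_seq (sum_n (fun n => r ^ n * cos (INR (S n) * x))) ((cos x - r) / d)).
  apply (is_lim_seq_ext (fun N => (cos x - r - (r ^ S N * cos (INR (S (S N)) * x)
     - r * (r ^ S N * cos (INR (S N) * x)))) / d)).
  - intros N; apply Rmult_eq_reg_r with d; [|lra].
    unfold Rdiv; rewrite Rmult_assoc, Rinv_l, Rmult_1_r by lra.
    assert (rec : forall n, cos (INR (S (S n)) * x)
              = 2 * cos x * cos (INR (S n) * x) - cos (INR n * x)).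
    { intros n; rewrite !S_INR.
      replace ((INR n + 1 + 1) * x) with ((INR n + 1) * x + x) by ring.
      replace (INR n * x) with ((INR n + 1) * x - x) by ring.
      rewrite cos_plus, cos_minus; ring. }
    induction N as [|N IH].
    + rewrite sum_O, (rec 0%nat); simpl INR; rewrite Rmult_0_l, cos_0.
      unfold d; rewrite Rmult_1_l; ring.
    + rewrite sum_Sn; R_ops.
      rewrite Rmult_plus_distr_r, <- IH, (rec (S N)).
      unfold d; simpl pow; ring.
  - replace (Finite ((cos x - r) / d)) with (Finite ((cos x - r - (0 - r * 0)) / d))
      by (f_equal; f_equal; ring).
    assert (G : forall k, is_lim_seq (fun N => r ^ S N * cos (INR (k + S N) * x)) 0).
    { intros k.
      apply is_lim_seq_abs_0.
      apply (is_lim_seq_le_le (fun _ => 0) _ (fun N => Rabs r ^ S N)).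
      - intros N; split; [apply Rabs_pos|].
        rewrite RPow_abs; apply Rabs_mult_le_1, Rabs_cos_le.
      - apply is_lim_seq_const.
      - apply (proj1 (is_lim_seq_incr_1 (fun n => Rabs r ^ n) 0)).
        apply is_lim_seq_geom; now rewrite Rabs_Rabsolu. }
    apply is_lim_seq_mult'; [|apply is_lim_seq_const].
    apply is_lim_seq_minus'; [apply is_lim_seq_const|].
    apply is_lim_seq_minus'; [apply (G 1%nat)|].
    apply is_lim_seq_mult'; [apply is_lim_seq_const|apply (G 0%nat)].
Qed.

Lemma Fcos_0 (r x : R) : Rabs r < 1 ->
  Fcos r 0 x = r * ((cos x - r) / (1 - 2 * r * cos x + r ^ 2)).
Proof.
  intros H; rewrite <- (is_series_unique _ _ (is_series_geom_cos r x H)).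
  rewrite <- Series_scal_l; apply Series_ext.
  intros n; unfold weight; simpl pow; field.
Qed.

(** Both sides vanish at [r = 0] and have the same derivative in [r], a geometric
    cosine sum. *)
Lemma Fcos_1 (r x : R) : 0 <= r < 1 ->
  Fcos r 1 x = - (1 / 2) * ln (1 - 2 * r * cos x + r ^ 2).
Proof.
  intros Hr.
  set (h := fun y => Fcos y 1 x + 1 / 2 * ln (1 - 2 * y * cos x + y ^ 2)).
  set (q := (1 + r) / 2).
  assert (Q : 0 < q < 1 /\ r < q) by (unfold q; lra).
  assert (AB : forall y, - q < y < q -> Rabs y < 1)
    by (intros y Hy; apply Rabs_def1; lra).
  assert (Hd : forall y, - q < y < q -> is_derive h y 0).
  { intros y Hy; assert (Y := AB y Hy); assert (D := poisson_den_pos y x Y).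
    replace 0 with ((cos x - y) / (1 - 2 * y * cos x + y ^ 2)
      + (y - cos x) / (1 - 2 * y * cos x + y ^ 2)) by (field; lra).
    apply (is_derive_plus (K := R_AbsRing) (V := R_NormedModule)).
    - rewrite <- (is_series_unique _ _ (is_series_geom_cos y x Y)).
      apply (is_derive_Series (fun n t => weight t 1 n * cos (INR (S n) * x))
        (fun n t => t ^ n * cos (INR (S n) * x)) (fun n => q ^ n) (- q) q);
        [exact Hy | | | | |].
      + intros n t _; unfold weight.
        generalize (cos (INR (S n) * x)); intros c.
        auto_derive; [trivial|].
        change (Nat.pred (S n)) with n; field; apply Rgt_not_eq, INR_S_pos.
      + intros n t _; apply (ex_derive_continuous (V := R_NormedModule)).
        generalize (cos (INR (S n) * x)); intros; auto_derive; trivial.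
      + intros n t Ht; eapply Rle_trans; [apply Rabs_mult_le_1, Rabs_cos_le|].
        rewrite <- RPow_abs; apply pow_incr; split; [apply Rabs_pos|].
        apply Rabs_le; lra.
      + apply ex_series_geom; rewrite Rabs_right; lra.
      + intros t Ht; apply Fcos_ex, summable_lt1, AB, Ht.
    - auto_derive; [lra|field; lra]. }
  assert (E : h 0 = h r).
  { destruct (Req_dec r 0) as [->|]; [reflexivity|].
    apply (eq_is_derive (V := R_NormedModule)); [|lra].
    intros t Ht; apply Hd; lra. }
  assert (E0 : h 0 = 0).
  { unfold h, Fcos.
    replace (1 - 2 * 0 * cos x + 0 ^ 2) with 1 by ring; rewrite ln_1.
    rewrite Series_zero; [ring|].
    intros n; unfold weight; simpl pow; unfold Rdiv; ring. }
  unfold h in E at 2; lra.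
Qed.

(** This form shows the limit [4 sin (x / 2) ^ 2] as [r] tends to 1, and that the
    denominator stays away from 0 when [x] does. *)
Lemma poisson_den_half (r x : R) :
  1 - 2 * r * cos x + r ^ 2 = (1 - r) ^ 2 + 4 * r * sin (x / 2) ^ 2.
Proof.
  replace x with (2 * (x / 2)) at 1 by field; rewrite cos_2a_sin; ring.
Qed.

Lemma sin_half_lb (a x : R) : 0 < a -> a < x <= PI -> 0 < sin (a / 2) <= sin (x / 2).
Proof.
  intros Ha Hx; split; [apply sin_gt_0; lra|].
  left; apply sin_increasing_1; lra.
Qed.

Lemma Rabs_ln_le (q u v : R) : 0 < q -> / q <= 1 + u -> q <= 1 + v -> 0 <= u -> 0 <= v ->
  Rabs (ln q) <= u + v.
Proof.
  intros Hq H1 H2 Hu Hv.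
  assert (L : forall z, 0 < z -> ln z <= z - 1).
  { intros z Hz; destruct (Req_dec (ln z) 0) as [E|N].
    - rewrite E, <- (exp_ln z Hz), E, exp_0; lra.
    - generalize (exp_ineq1 _ N); rewrite exp_ln by exact Hz; lra. }
  assert (L1 := L q Hq); assert (L2 := L (/ q) (Rinv_0_lt_compat _ Hq)).
  rewrite ln_Rinv in L2 by exact Hq.
  apply Rabs_le; lra.
Qed.

(** By [poisson_den_half] the error is half the logarithm of
    [q = r + (1 - r)^2 / (4 sin (x/2)^2)], and [q] is close to 1 uniformly for
    [x >= a]. *)
Lemma Fcos_1_approx (a t x : R) : 0 < t -> 0 < a -> a < x < PI ->
  Rabs (Fcos (abel_radius t) 1 x - - ln (2 * sin (x / 2)))
    <= t ^ 2 + t ^ 4 / (4 * sin (a / 2) ^ 2).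
Proof.
  intros Ht Ha Hx.
  destruct (sin_half_lb a x Ha) as [S0 S1]; [lra|].
  assert (R1 := abel_radius_lt1 t Ht).
  rewrite Fcos_1 by lra; rewrite poisson_den_half.
  set (s := sin (x / 2)) in *; set (o := sin (a / 2)) in *; set (r := abel_radius t) in *.
  assert (S2 : o ^ 2 <= s ^ 2) by nra.
  assert (O2 : 0 < o ^ 2) by nra.
  set (q := r + (1 - r) ^ 2 / (4 * s ^ 2)).
  assert (Q0 : 0 <= (1 - r) ^ 2 / (4 * s ^ 2)).
  { apply Rmult_le_pos; [apply pow2_ge_0|left; apply Rinv_0_lt_compat; nra]. }
  replace ((1 - r) ^ 2 + 4 * r * s ^ 2) with (q * (2 * s) * (2 * s))
    by (unfold q; field; lra).
  rewrite !ln_mult by (unfold q; nra).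
  match goal with |- Rabs ?z <= _ => replace z with (- (1 / 2) * ln q) by field end.
  rewrite Rabs_mult, Rabs_Ropp, (Rabs_right (1 / 2)) by lra.
  assert (IR : / r = 1 + t ^ 2) by (unfold r, abel_radius; rewrite Rinv_inv; reflexivity).
  assert (T4 : 0 <= t ^ 4 / (4 * o ^ 2)).
  { apply Rmult_le_pos; [apply pow_le; lra|left; apply Rinv_0_lt_compat; lra]. }
  assert (R2 : 0 <= 1 - r <= t ^ 2).
  { assert (r * (1 + t ^ 2) = 1) by (rewrite <- IR; field; lra). nra. }
  assert (L : Rabs (ln q) <= t ^ 2 + t ^ 4 / (4 * o ^ 2)).
  { apply Rabs_ln_le; [unfold q; lra | | | nra | exact T4].
    - rewrite <- IR; apply Rinv_le_contravar; unfold q; lra.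
    - unfold q; apply Rplus_le_compat; [lra|].
      apply Rmult_le_compat; [apply pow2_ge_0 | left; apply Rinv_0_lt_compat; nra | |].
      + replace (t ^ 4) with ((t ^ 2) ^ 2) by ring; apply pow_incr, R2.
      + apply Rinv_le_contravar; lra. }
  assert (P := Rabs_pos (ln q)); lra.
Qed.

Lemma lim_at_inv_S (p : R -> R) : continuous p 0 -> p 0 = 0 ->
  is_lim_seq (fun n => p (/ INR (S n))) 0.
Proof.
  intros C E; rewrite <- E.
  apply (is_lim_seq_continuous p (fun n => / INR (S n)) 0);
    [apply continuity_pt_filterlim, C | exact inv_S_lim].
Qed.

Lemma inv_S_pos (n : nat) : 0 < / INR (S n).
Proof. apply Rinv_0_lt_compat, INR_S_pos. Qed.

Lemma abel_radius_abs_lt1 (n : nat) : Rabs (abel_radius (/ INR (S n))) < 1.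
Proof.
  generalize (abel_radius_lt1 _ (inv_S_pos n)); intros; apply Rabs_def1; lra.
Qed.

(** The Abel means of the derivative are logarithms by [Fcos_1], and their limit is
    locally uniform by [Fcos_1_approx]. *)
Lemma Fsin_2_derive (x : R) : 0 < x < PI ->
  is_derive (Fsin 1 2) x (- ln (2 * sin (x / 2))).
Proof.
  intros Hx; set (o := sin (x / 2 / 2)).
  assert (O : 0 < o) by (apply (sin_half_lb (x / 2) x); lra).
  apply (is_derive_limit (fun n => Fsin (abel_radius (/ INR (S n))) 2)
    (fun n => Fcos (abel_radius (/ INR (S n))) 1) (Fsin 1 2) (fun y => - ln (2 * sin (y / 2)))
    (fun n => (/ INR (S n)) ^ 2 + (/ INR (S n)) ^ 4 / (4 * o ^ 2)) (x / 2) PI);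
    [lra | | | | |].
  - intros n y _; apply Fsin_derive, summable_lt1, abel_radius_abs_lt1.
  - intros y _; apply (Series_abel_lim 2 (fun k => sin (INR (S k) * y))); [lia|].
    intros k; apply Rabs_sin_le.
  - intros n y Hy; apply Fcos_1_approx; [apply inv_S_pos | lra | exact Hy].
  - apply (lim_at_inv_S (fun t => t ^ 2 + t ^ 4 / (4 * o ^ 2))); [|field; lra].
    apply (ex_derive_continuous (V := R_NormedModule)); auto_derive; nra.
  - intros y Hy; apply (ex_derive_continuous (V := R_NormedModule)).
    auto_derive; repeat split.
    destruct (sin_half_lb (x / 2) y); lra.
Qed.

Lemma sin_nPI (n : nat) : sin (INR n * PI) = 0.
Proof. apply sin_eq_0_1; exists (Z.of_nat n); now rewrite <- INR_IZR_INZ. Qed.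

Lemma Fsin_PI (r : R) (s : nat) : Fsin r s PI = 0.
Proof.
  apply Series_zero; intros n; rewrite sin_nPI; ring.
Qed.

(** The difference vanishes at [PI], and its derivative is the Poisson kernel
    [(1 - r^2) / (2 d)], which tends to 0 uniformly away from [x = 0]; the mean value
    theorem between [x] and [PI] concludes. *)
Lemma Fsin_1_approx (a t x : R) : 0 < t -> 0 < a -> a < x < PI ->
  Rabs (- Fsin (abel_radius t) 1 x - (x - PI) / 2) <= t ^ 2 / sin (a / 2) ^ 2 * PI.
Proof.
  intros Ht Ha Hx.
  assert (R1 := abel_radius_lt1 t Ht).
  assert (AR : Rabs (abel_radius t) < 1) by (apply Rabs_def1; lra).
  set (h := fun y => - Fsin (abel_radius t) 1 y - (y - PI) / 2).
  assert (Hd : forall y, is_derive h y (- Fcos (abel_radius t) 0 y - 1 / 2)).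
  { intros y; apply (is_derive_minus (K := R_AbsRing) (V := R_NormedModule)).
    - apply (is_derive_opp (K := R_AbsRing) (V := R_NormedModule)).
      apply Fsin_derive, summable_lt1, AR.
    - auto_derive; [trivial|field]. }
  destruct (MVT_gen h x PI (fun y => - Fcos (abel_radius t) 0 y - 1 / 2)) as [c [Hc E]].
  - intros y _; apply Hd.
  - intros y _; apply continuity_pt_filterlim, (continuous_of_is_derive h y _ (Hd y)).
  - rewrite Rmin_left, Rmax_right in Hc by lra.
    unfold h in E; rewrite Fsin_PI in E.
    replace (- Fsin (abel_radius t) 1 x - (x - PI) / 2)
      with (- (- Fcos (abel_radius t) 0 c - 1 / 2) * (PI - x)) by lra.
    rewrite Fcos_0 by exact AR.
    destruct (sin_half_lb a c Ha) as [S0 S1]; [lra|].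
    assert (D := poisson_den_pos (abel_radius t) c AR).
    assert (DH := poisson_den_half (abel_radius t) c).
    set (d := 1 - 2 * abel_radius t * cos c + abel_radius t ^ 2) in *.
    replace (- (- (abel_radius t * ((cos c - abel_radius t) / d)) - 1 / 2))
      with ((1 - abel_radius t ^ 2) / (2 * d)) by (unfold d in *; field; lra).
    set (s := sin (c / 2)) in *; set (o := sin (a / 2)) in *; set (r := abel_radius t) in *.
    assert (S2 : 0 < o ^ 2 <= s ^ 2) by nra.
    assert (RI : r * (1 + t ^ 2) = 1).
    { unfold r, abel_radius; field; generalize (pow2_ge_0 t); lra. }
    assert (N1 : 0 <= (1 - r ^ 2) / (2 * d)).
    { apply Rmult_le_pos; [nra|left; apply Rinv_0_lt_compat; lra]. }
    rewrite Rabs_right by (apply Rle_ge, Rmult_le_pos; lra).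
    apply Rmult_le_compat; [exact N1 | lra | | lra].
    apply Rle_div_l; [lra|].
    replace (t ^ 2 / o ^ 2 * (2 * d)) with (2 * t ^ 2 * (d / o ^ 2)) by (field; lra).
    assert (D4 : 4 * r <= d / o ^ 2) .
    { apply (proj1 (Rle_div_r (4 * r) d (o ^ 2) (proj1 S2))); rewrite DH.
      assert (0 <= r * (s ^ 2 - o ^ 2)) by (apply Rmult_le_pos; lra).
      generalize (pow2_ge_0 (1 - r)); lra. }
    apply Rle_trans with (2 * t ^ 2 * (4 * r)).
    { replace (1 - r ^ 2) with ((1 - r) * (1 + r)) by ring.
      replace (1 - r) with (r * t ^ 2) by lra.
      assert (R3 : 0 <= r * t ^ 2) by (apply Rmult_le_pos; [lra|apply pow2_ge_0]).
      nra. }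
    apply Rmult_le_compat_l; [nra|exact D4].
Qed.

Lemma Fcos_2_derive (x : R) : 0 < x < PI ->
  is_derive (Fcos 1 2) x ((x - PI) / 2).
Proof.
  intros Hx; set (o := sin (x / 2 / 2)).
  assert (O : 0 < o) by (apply (sin_half_lb (x / 2) x); lra).
  apply (is_derive_limit (fun n => Fcos (abel_radius (/ INR (S n))) 2)
    (fun n y => - Fsin (abel_radius (/ INR (S n))) 1 y) (Fcos 1 2) (fun y => (y - PI) / 2)
    (fun n => (/ INR (S n)) ^ 2 / o ^ 2 * PI) (x / 2) PI);
    [lra | | | | |].
  - intros n y _; apply Fcos_derive, summable_lt1, abel_radius_abs_lt1.
  - intros y _; apply (Series_abel_lim 2 (fun k => cos (INR (S k) * y))); [lia|].
    intros k; apply Rabs_cos_le.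
  - intros n y Hy; apply Fsin_1_approx; [apply inv_S_pos | lra | exact Hy].
  - apply (lim_at_inv_S (fun t => t ^ 2 / o ^ 2 * PI)); [|field; lra].
    apply (ex_derive_continuous (V := R_NormedModule)); auto_derive; nra.
  - intros y Hy; apply (ex_derive_continuous (V := R_NormedModule)).
    auto_derive; trivial.
Qed.

(** * Values at sixths of the circle *)

Lemma weight_1 (s n : nat) : weight 1 s n = / INR (S n) ^ s.
Proof. unfold weight; rewrite pow1; unfold Rdiv; ring. Qed.

Lemma summable_1 (s : nat) : (2 <= s)%nat -> summable 1 s.
Proof. intros H; apply summable_sq; [rewrite Rabs_R1; lra | exact H]. Qed.

Lemma cos_nPI (n : nat) : cos (INR n * PI) = (-1) ^ n.
Proof.
  induction n as [|n IH].
  - rewrite Rmult_0_l; apply cos_0.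
  - rewrite S_INR, Rmult_plus_distr_r, Rmult_1_l, neg_cos, IH; simpl; ring.
Qed.

(** If [u] vanishes at odd indices and is [2 v] at half the index for even ones, then only
    the even half of the series of [u] survives, and it is a rescaled series of [v]. *)
Lemma parity_block (u v : nat -> R) (s : nat) (l l' : R) :
  is_series (fun n => weight 1 s n * u (S n)) l ->
  is_series (fun n => weight 1 s n * v (S n)) l' ->
  (forall j, u (2 * j + 1)%nat = 0) ->
  (forall j, u (2 * j)%nat = 2 * v j) ->
  l = 2 / 2 ^ s * l'.
Proof.
  intros Hu Hv Hodd Heven.
  apply (is_series_block _ 1) in Hu.
  apply is_series_unique in Hu; apply is_series_unique in Hv.
  rewrite <- Hu, <- Hv, <- Series_scal_l.
  apply Series_ext; intros j.
  rewrite sum_Sn, sum_O; R_ops.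
  replace (S (2 * j + 0)) with (2 * j + 1)%nat by lia.
  replace (S (2 * j + 1)) with (2 * S j)%nat by lia.
  rewrite Hodd, Heven, !weight_1, Rmult_0_r, Rplus_0_l.
  replace (S (2 * j + 1)) with (2 * S j)%nat by lia.
  rewrite mult_INR, Rpow_mult_distr; change (INR 2) with 2.
  generalize (INR_S_pos j); generalize (INR (S j)); intros k Hk.
  field; split; apply pow_nonzero; lra.
Qed.

Lemma Fcos_dup (s : nat) (x : R) : (2 <= s)%nat ->
  Fcos 1 s x + Fcos 1 s (PI - x) = 2 / 2 ^ s * Fcos 1 s (2 * x).
Proof.
  intros Hs; assert (H := summable_1 s Hs).
  apply (parity_block (fun n => cos (INR n * x) + cos (INR n * (PI - x)))
    (fun n => cos (INR n * (2 * x))) s).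
  - apply (is_series_ext (fun n => plus (weight 1 s n * cos (INR (S n) * x))
        (weight 1 s n * cos (INR (S n) * (PI - x))))).
    + intros n; symmetry; apply Rmult_plus_distr_l.
    + apply (is_series_plus (K := R_AbsRing) (V := R_NormedModule));
        apply Series_correct, Fcos_ex, H.
  - apply Series_correct, Fcos_ex, H.
  - intros j; rewrite Rmult_minus_distr_l, cos_minus, cos_nPI, sin_nPI.
    rewrite pow_add, pow_1_even; ring.
  - intros j; rewrite Rmult_minus_distr_l, cos_minus, cos_nPI, sin_nPI, pow_1_even.
    rewrite mult_INR; change (INR 2) with 2.
    replace (2 * INR j * x) with (INR j * (2 * x)) by ring; ring.
Qed.

Lemma Fsin_dup (s : nat) (x : R) : (2 <= s)%nat ->
  Fsin 1 s x - Fsin 1 s (PI - x) = 2 / 2 ^ s * Fsin 1 s (2 * x).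
Proof.
  intros Hs; assert (H := summable_1 s Hs).
  apply (parity_block (fun n => sin (INR n * x) - sin (INR n * (PI - x)))
    (fun n => sin (INR n * (2 * x))) s).
  - apply (is_series_ext (fun n => minus (weight 1 s n * sin (INR (S n) * x))
        (weight 1 s n * sin (INR (S n) * (PI - x))))).
    + intros n; symmetry; apply Rmult_minus_distr_l.
    + apply (is_series_minus (K := R_AbsRing) (V := R_NormedModule));
        apply Series_correct, Fsin_ex, H.
  - apply Series_correct, Fsin_ex, H.
  - intros j; rewrite Rmult_minus_distr_l, sin_minus, cos_nPI, sin_nPI.
    rewrite pow_add, pow_1_even; ring.
  - intros j; rewrite Rmult_minus_distr_l, sin_minus, cos_nPI, sin_nPI, pow_1_even.
    rewrite mult_INR; change (INR 2) with 2.
    replace (2 * INR j * x) with (INR j * (2 * x)) by ring; ring.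
Qed.

Lemma third_turn_period (j i : nat) :
  INR (3 * j + i) * (2 * (PI / 3)) = INR i * (2 * (PI / 3)) + 2 * INR j * PI.
Proof. rewrite plus_INR, mult_INR; simpl (INR 3); field. Qed.

Lemma cos_third (j : nat) :
  cos (INR (3 * j + 1) * (2 * (PI / 3))) = - (1 / 2) /\
  cos (INR (3 * j + 2) * (2 * (PI / 3))) = - (1 / 2) /\
  cos (INR (3 * j + 3) * (2 * (PI / 3))) = 1.
Proof.
  rewrite !third_turn_period, !cos_period; simpl INR.
  replace (1 * (2 * (PI / 3))) with (2 * (PI / 3)) by ring.
  replace ((1 + 1) * (2 * (PI / 3))) with (PI / 3 + PI) by field.
  replace ((1 + 1 + 1) * (2 * (PI / 3))) with (2 * PI) by field.
  rewrite cos_2PI3, neg_cos, cos_PI3, cos_2PI; lra.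
Qed.

Lemma sin_third (j : nat) :
  sin (INR (3 * j + 1) * (2 * (PI / 3))) = sqrt 3 / 2 /\
  sin (INR (3 * j + 2) * (2 * (PI / 3))) = - (sqrt 3 / 2) /\
  sin (INR (3 * j + 3) * (2 * (PI / 3))) = 0.
Proof.
  rewrite !third_turn_period, !sin_period; simpl INR.
  replace (1 * (2 * (PI / 3))) with (2 * (PI / 3)) by ring.
  replace ((1 + 1) * (2 * (PI / 3))) with (PI / 3 + PI) by field.
  replace ((1 + 1 + 1) * (2 * (PI / 3))) with (2 * PI) by field.
  rewrite sin_2PI3, neg_sin, sin_PI3, sin_2PI; lra.
Qed.

Lemma is_series_thirds (u : nat -> R) (s : nat) (l : R) :
  is_series (fun n => weight 1 s n * u (S n)) l ->
  is_series (fun j => u (3 * j + 1)%nat / (3 * INR j + 1) ^ s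
    + u (3 * j + 2)%nat / (3 * INR j + 2) ^ s
    + u (3 * j + 3)%nat / (3 ^ s) * weight 1 s j) l.
Proof.
  intros H; apply (is_series_block _ 2) in H.
  revert H; apply is_series_ext; intros j.
  rewrite !sum_Sn, sum_O; R_ops.
  replace (S (3 * j + 0)) with (3 * j + 1)%nat by lia.
  replace (S (3 * j + 1)) with (3 * j + 2)%nat by lia.
  replace (S (3 * j + 2)) with (3 * j + 3)%nat by lia.
  rewrite !weight_1.
  replace (INR (S (3 * j + 0))) with (3 * INR j + 1)
    by (rewrite S_INR, plus_INR, mult_INR; simpl; ring).
  replace (INR (S (3 * j + 1))) with (3 * INR j + 2)
    by (rewrite S_INR, plus_INR, mult_INR; simpl; ring).
  replace (INR (S (3 * j + 2))) with (3 * INR (S j))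
    by (rewrite !S_INR, plus_INR, mult_INR; simpl; ring).
  rewrite Rpow_mult_distr.
  rewrite Rinv_mult; unfold Rdiv; ring.
Qed.

Lemma Fcos_0_series (s : nat) : (2 <= s)%nat ->
  is_series (weight 1 s) (Fcos 1 s 0).
Proof.
  intros Hs; apply (is_series_ext (fun n => weight 1 s n * cos (INR (S n) * 0))).
  - intros n; rewrite Rmult_0_r, cos_0; R_ops; ring.
  - apply Series_correct, Fcos_ex, summable_1, Hs.
Qed.

(** The values of [cos] at the three multiples of [2 PI / 3] sum to 0, so [C3 0 + 2 C3
    (2 PI / 3)] keeps only the multiples of 3 and equals [3 / 3^3 * C3 0]. *)
Lemma Fcos_3_third : Fcos 1 3 (2 * (PI / 3)) = - (4 / 9) * Fcos 1 3 0.
Proof.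
  assert (H0 := Fcos_0_series 3 ltac:(lia)).
  assert (H1 : is_series (fun n => weight 1 3 n * cos (INR (S n) * (2 * (PI / 3))))
    (Fcos 1 3 (2 * (PI / 3)))) by (apply Series_correct, Fcos_ex, summable_1; lia).
  assert (H0' : is_series (fun n => weight 1 3 n * (fun _ => 1) (S n)) (Fcos 1 3 0))
    by (revert H0; apply is_series_ext; intros; R_ops; ring).
  apply is_series_thirds in H0'.
  apply (is_series_thirds (fun n => cos (INR n * (2 * (PI / 3))))) in H1.
  assert (E := is_series_scal_l 2 _ _ H1).
  assert (E2 := is_series_plus _ _ _ _ H0' E).
  apply (is_series_ext _ (fun n => scal (1 / 9) (weight 1 3 n))) in E2.
  - apply is_series_unique in E2.
    assert (E3 := eq_trans (eq_sym (is_series_unique _ _ (is_series_scal_l (1 / 9) _ _ H0))) E2).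
    change (1 / 9 * Fcos 1 3 0 = Fcos 1 3 0 + 2 * Fcos 1 3 (2 * (PI / 3))) in E3.
    lra.
  - intros j; destruct (cos_third j) as [-> [-> ->]].
    R_ops.
    assert (P0 := pos_INR j); field; lra.
Qed.

(** The sum of [cos (n x) / n^2] differs from [(x - PI)^2 / 4] by a constant on [0, PI], and
    duplication at 0 gives its value at [PI] as minus half its value at 0. *)
Lemma basel : Fcos 1 2 0 = PI ^ 2 / 6.
Proof.
  assert (P := PI_RGT_0).
  assert (E := eq_of_derive_0 (fun x => Fcos 1 2 x - (x - PI) ^ 2 / 4) 0 PI P).
  assert (D := Fcos_dup 2 0 ltac:(lia)).
  rewrite Rmult_0_r, Rminus_0_r in D.
  lapply E; [clear E; intros E; lapply E; [clear E; intros E|]|].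
  - nra.
  - intros x _; apply (continuous_minus (K := R_AbsRing) (V := R_NormedModule)).
    + apply Fcos_continuous; lia.
    + apply (ex_derive_continuous (V := R_NormedModule)); auto_derive; trivial.
  - intros x Hx; replace 0 with ((x - PI) / 2 - (x - PI) / 2) by ring.
    apply (is_derive_minus (K := R_AbsRing) (V := R_NormedModule)).
    + apply Fcos_2_derive, Hx.
    + auto_derive; [trivial|field].
Qed.

(** With [A] and [B] the sums of [1 / (3j+1)^2] and [1 / (3j+2)^2], the left side is
    [sqrt 3 / 2 * (A - B)], while [A + B] is 8/9 of the Basel sum.  Hence
    [A - B = 2 A - 4 PI^2 / 27], and [A = 1 + c1]. *)
Lemma Fsin_2_third : Fsin 1 2 (2 * (PI / 3)) = sqrt 3 / 2 * K.
Proof.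
  assert (Q : 0 < sqrt 3) by (apply sqrt_lt_R0; lra).
  assert (H0 := Fcos_0_series 2 ltac:(lia)).
  assert (H1 : is_series (fun n => weight 1 2 n * sin (INR (S n) * (2 * (PI / 3))))
    (Fsin 1 2 (2 * (PI / 3)))) by (apply Series_correct, Fsin_ex, summable_1; lia).
  assert (H0' : is_series (fun n => weight 1 2 n * (fun _ => 1) (S n)) (Fcos 1 2 0))
    by (revert H0; apply is_series_ext; intros; R_ops; ring).
  apply is_series_thirds in H0'.
  apply (is_series_thirds (fun n => sin (INR n * (2 * (PI / 3))))) in H1.
  (* The combination [((A + B) + (A - B)) / 2] isolates [A], which also proves that the
     series defining [c1] converges. *)
  assert (E := is_series_plus _ _ _ _
    (is_series_plus _ _ _ _ H0' (is_series_scal_l (- (1 / 9)) _ _ H0))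
    (is_series_scal_l (2 / sqrt 3) _ _ H1)).
  apply (is_series_scal_l (1 / 2)) in E.
  apply (is_series_ext _ (fun j => 1 / (1 + 3 * INR j) ^ 2)) in E.
  - assert (X : ex_series (fun j => 1 / (1 + 3 * INR j) ^ 2)) by (eexists; exact E).
    apply is_series_unique in E; rewrite (Series_incr_1 _ X) in E.
    change (Series (fun k => 1 / (1 + 3 * INR (S k)) ^ 2)) with Defs.c1 in E.
    rewrite basel in E.
    change (1 / (1 + 3 * INR 0) ^ 2 + Defs.c1 = 1 / 2 * (PI ^ 2 / 6 + - (1 / 9) * (PI ^ 2 / 6)
      + 2 / sqrt 3 * Fsin 1 2 (2 * (PI / 3)))) in E.
    simpl INR in E; unfold K.
    replace Defs.c1 with (1 / 2 * (PI ^ 2 / 6 + - (1 / 9) * (PI ^ 2 / 6)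
      + 2 / sqrt 3 * Fsin 1 2 (2 * (PI / 3))) - 1 / (1 + 3 * 0) ^ 2) by lra.
    field; lra.
  - intros j; destruct (sin_third j) as [-> [-> ->]].
    R_ops.
    assert (P0 := pos_INR j); field; lra.
Qed.

(** * The series of the squared arcsine *)

Definition cbinom (n : nat) : R := Binomial.C (2 * n) n.
Definition coef (k : nat) : R := / (INR (S k) ^ 2 * cbinom (S k)).

Lemma cbinom_0 : cbinom 0 = 1.
Proof. unfold cbinom, Binomial.C; simpl; field. Qed.

Lemma cbinom_succ (n : nat) : cbinom (S n) * (INR n + 1) = cbinom n * (2 * (2 * INR n + 1)).
Proof.
  unfold cbinom, Binomial.C.
  replace (2 * S n - S n)%nat with (S n) by lia.
  replace (2 * n - n)%nat with n by lia.
  replace (2 * S n)%nat with (S (S (2 * n))) by lia.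
  rewrite !fact_simpl, !mult_INR, !S_INR, mult_INR.
  change (INR 2) with 2.
  assert (P0 := pos_INR n); assert (F := INR_fact_neq_0 n).
  field; lra.
Qed.

Lemma cbinom_lb (k : nat) : 2 * 3 ^ k <= cbinom (S k).
Proof.
  induction k as [|k IH].
  - generalize (cbinom_succ 0); rewrite cbinom_0; simpl; lra.
  - assert (R := cbinom_succ (S k)); rewrite S_INR in R.
    assert (P0 := pos_INR k).
    assert (P3 : 0 < 3 ^ k) by (apply pow_lt; lra).
    change (3 ^ S k) with (3 * 3 ^ k).
    apply Rmult_le_reg_r with (INR k + 1 + 1); [lra|].
    rewrite R; nra.
Qed.

Lemma cbinom_pos (n : nat) : 0 < cbinom n.
Proof.
  destruct n as [|k]; [rewrite cbinom_0; lra|].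
  eapply Rlt_le_trans; [|apply cbinom_lb].
  apply Rmult_lt_0_compat; [lra|apply pow_lt; lra].
Qed.

Lemma pow_cbinom_bound (z : R) (k : nat) : 0 <= z <= 2 ->
  0 <= z ^ k / cbinom (S k) <= 1 / 2 * (2 / 3) ^ k.
Proof.
  intros Hz; assert (L := cbinom_lb k).
  assert (P3 : 0 < 3 ^ k) by (apply pow_lt; lra).
  assert (Z0 : 0 <= z ^ k) by (apply pow_le; lra).
  split.
  - apply Rmult_le_pos; [exact Z0|left; apply Rinv_0_lt_compat, cbinom_pos].
  - replace (1 / 2 * (2 / 3) ^ k) with (2 ^ k * / (2 * 3 ^ k)).
    + apply Rmult_le_compat; [exact Z0 | left; apply Rinv_0_lt_compat, cbinom_pos | |].
      * apply pow_incr, Hz.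
      * apply Rinv_le_contravar; [lra|exact L].
    + unfold Rdiv at 2; rewrite Rpow_mult_distr, pow_inv; field; lra.
Qed.

Lemma coef_eq (k : nat) : coef k * INR (S k) ^ 2 = / cbinom (S k).
Proof.
  unfold coef; generalize (INR_S_pos k) (cbinom_pos (S k)); intros; field; lra.
Qed.

Lemma coef_pos (k : nat) : 0 < coef k.
Proof.
  apply Rinv_0_lt_compat, Rmult_lt_0_compat; [apply pow_lt, INR_S_pos | apply cbinom_pos].
Qed.

Lemma coef_S_bound (k : nat) : 0 <= coef k * INR (S k) <= / cbinom (S k).
Proof.
  rewrite <- coef_eq; assert (P := coef_pos k).
  assert (1 <= INR (S k)) by (apply (le_INR 1); lia).
  split; [apply Rmult_le_pos; lra|].
  apply Rmult_le_compat_l; [lra|nra].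
Qed.

Lemma coef_bound (k : nat) : 0 <= coef k <= / cbinom (S k).
Proof.
  generalize (coef_S_bound k) (coef_pos k); intros.
  assert (1 <= INR (S k)) by (apply (le_INR 1); lia).
  nra.
Qed.

Lemma ex_series_geom_23 (c : R) : ex_series (fun k => c * (2 / 3) ^ k).
Proof.
  apply (ex_series_scal_l (K := R_AbsRing) (V := R_NormedModule) c).
  apply ex_series_geom; rewrite Rabs_right; lra.
Qed.

(** The square of the chord of angle [2 t], that is [w^2] for [w = 2 sin t]. *)
Definition sq_chord (t : R) : R := 4 * sin t ^ 2.

(** The bound 2, half the radius of convergence of the series in [w^2], leaves room for a
    neighbourhood of [0, PI / 6]. *)
Lemma sq_chord_bound (t : R) : - (7 / 10) < t < 7 / 10 -> 0 <= sq_chord t <= 2.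
Proof.
  intros Ht; unfold sq_chord.
  assert (H : forall x, 0 <= x < 7 / 10 -> 0 <= sin x <= 7 / 10).
  { intros x Hx; generalize PI2_3_2; intros.
    split; [apply sin_ge_0; lra|].
    destruct (Req_dec x 0) as [->|]; [rewrite sin_0; lra|].
    generalize (sin_lt_x x); lra. }
  destruct (Rle_dec 0 t) as [P|P].
  - generalize (H t); nra.
  - generalize (H (- t)); rewrite sin_neg; nra.
Qed.

(** The sum is [2 arcsin^2 (w / 2)] for [w = 2 sin t], hence [2 t^2]; the series
    definition of the derivative [arcsin_sq'] is used until that is known. *)
Definition arcsin_sq (t : R) : R := Series (fun k => coef k * sq_chord t ^ S k).
Definition arcsin_sq' (t : R) : R :=
  Series (fun k => coef k * INR (S k) * (sq_chord t ^ k * (8 * sin t * cos t))).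

Lemma arcsin_sq_ex (t : R) : - (7 / 10) < t < 7 / 10 ->
  ex_series (fun k => coef k * sq_chord t ^ S k).
Proof.
  intros Ht; apply ex_series_dom with (2 := ex_series_geom_23 1); intros k.
  assert (Z := sq_chord_bound t Ht); assert (B := pow_cbinom_bound _ k Z).
  assert (Z0 : 0 <= sq_chord t ^ k) by (apply pow_le; lra).
  assert (N := coef_bound k).
  change (sq_chord t ^ S k) with (sq_chord t * sq_chord t ^ k).
  rewrite Rabs_right by (apply Rle_ge, Rmult_le_pos; [|apply Rmult_le_pos]; lra).
  unfold Rdiv in B at 1.
  assert (coef k * sq_chord t ^ k <= sq_chord t ^ k * / cbinom (S k))
    by (rewrite Rmult_comm; apply Rmult_le_compat_l; lra).
  assert (0 <= coef k * sq_chord t ^ k) by (apply Rmult_le_pos; lra).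
  nra.
Qed.

Lemma arcsin_sq'_bound (k : nat) (t : R) : - (7 / 10) < t < 7 / 10 ->
  Rabs (coef k * INR (S k) * (sq_chord t ^ k * (8 * sin t * cos t))) <= 4 * (2 / 3) ^ k.
Proof.
  intros Ht; assert (Z := sq_chord_bound t Ht); assert (B := pow_cbinom_bound _ k Z).
  assert (Z0 : 0 <= sq_chord t ^ k) by (apply pow_le; lra).
  assert (N := coef_S_bound k).
  rewrite <- Rmult_assoc.
  apply Rle_trans with (Rabs (coef k * INR (S k) * sq_chord t ^ k) * 8).
  - rewrite Rabs_mult; apply Rmult_le_compat_l; [apply Rabs_pos|].
    rewrite Rmult_assoc, Rabs_mult, (Rabs_right 8) by lra.
    assert (Rabs (sin t * cos t) <= 1); [|lra].
    eapply Rle_trans; [apply Rabs_mult_le_1, Rabs_cos_le | apply Rabs_sin_le].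
  - rewrite Rabs_right by (apply Rle_ge, Rmult_le_pos; lra).
    unfold Rdiv in B at 1; nra.
Qed.

Lemma sq_chord_pow_derive (k : nat) (t : R) :
  is_derive (fun t => sq_chord t ^ k) t (INR k * (8 * sin t * cos t) * sq_chord t ^ pred k).
Proof.
  apply (is_derive_pow sq_chord); unfold sq_chord; auto_derive; [trivial|ring].
Qed.

Lemma sq_chord_pow_derive2 (k : nat) (t : R) :
  is_derive (fun t => sq_chord t ^ k * (8 * sin t * cos t)) t
    (sq_chord t ^ k * (8 * (2 * INR k + 1) - 4 * (INR k + 1) * sq_chord t)).
Proof.
  replace (sq_chord t ^ k * (8 * (2 * INR k + 1) - 4 * (INR k + 1) * sq_chord t))
    with (INR k * (8 * sin t * cos t) * sq_chord t ^ pred k * (8 * sin t * cos t)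
      + sq_chord t ^ k * (8 * (cos t * cos t) - 8 * (sin t * sin t))).
  - apply (is_derive_mult (fun t => sq_chord t ^ k) (fun t => 8 * sin t * cos t)).
    + apply sq_chord_pow_derive.
    + auto_derive; [trivial|ring].
    + exact Rmult_comm.
  - assert (C2 : cos t * cos t = 1 - sin t * sin t)
      by (generalize (sin2_cos2 t); unfold Rsqr; lra).
    transitivity (16 * INR k * (4 * (sin t * sin t) * sq_chord t ^ pred k) * (cos t * cos t)
      + sq_chord t ^ k * (8 * (cos t * cos t) - 8 * (sin t * sin t))); [ring|].
    rewrite C2; destruct k as [|k]; [unfold sq_chord; simpl; ring|].
    change (Nat.pred (S k)) with k; change (sq_chord t ^ S k) with (sq_chord t * sq_chord t ^ k).
    generalize (INR (S k)) (sq_chord t ^ k); intros n p; unfold sq_chord; ring.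
Qed.

Lemma arcsin_sq_derive (t : R) : - (7 / 10) < t < 7 / 10 -> is_derive arcsin_sq t (arcsin_sq' t).
Proof.
  intros Ht.
  apply (is_derive_Series (fun k t => coef k * sq_chord t ^ S k)
    (fun k t => coef k * INR (S k) * (sq_chord t ^ k * (8 * sin t * cos t)))
    (fun k => 4 * (2 / 3) ^ k) (- (7 / 10)) (7 / 10));
    [exact Ht | | | | apply ex_series_geom_23 | exact arcsin_sq_ex].
  - intros k y _; rewrite Rmult_assoc.
    apply (is_derive_scal (fun t => sq_chord t ^ S k)).
    replace (INR (S k) * (sq_chord y ^ k * (8 * sin y * cos y)))
      with (INR (S k) * (8 * sin y * cos y) * sq_chord y ^ pred (S k))
      by (change (Nat.pred (S k)) with k; ring).
    apply sq_chord_pow_derive.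
  - intros k y _.
    apply (continuous_scal_r (K := R_AbsRing) (V := R_NormedModule) (coef k * INR (S k))).
    exact (continuous_of_is_derive _ _ _ (sq_chord_pow_derive2 k y)).
  - exact arcsin_sq'_bound.
Qed.

(** By the recurrence of the central binomial coefficients, the derivative of the term of
    index [k] is [4 z^k / cbinom k - 4 z^(k+1) / cbinom (k+1)] with [z = sq_chord t]:
    the series telescopes. *)
Lemma arcsin_sq'_derive (t : R) : - (7 / 10) < t < 7 / 10 -> is_derive arcsin_sq' t 4.
Proof.
  intros Ht.
  set (g := fun (k : nat) (t : R) => 4 * (sq_chord t ^ k / cbinom k - sq_chord t ^ S k / cbinom (S k))).
  assert (E : is_series (fun k => g k t) 4).
  { change (is_lim_seq (sum_n (fun k => g k t)) 4).
    apply (is_lim_seq_ext (fun N => 4 - 4 * (sq_chord t ^ S N / cbinom (S N)))).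
    - intros N; induction N as [|N IH].
      + rewrite sum_O; unfold g; rewrite cbinom_0; simpl pow; field.
        apply Rgt_not_eq, cbinom_pos.
      + rewrite sum_Sn, <- IH; unfold g; R_ops; ring.
    - replace (Finite 4) with (Finite (4 - 4 * 0)) by (f_equal; ring).
      apply is_lim_seq_minus'; [apply is_lim_seq_const|].
      apply is_lim_seq_mult'; [apply is_lim_seq_const|].
      apply (is_lim_seq_le_le (fun _ => 0) _ (fun N => (2 / 3) ^ N)).
      + intros N; assert (Z := sq_chord_bound t Ht); assert (B := pow_cbinom_bound _ N Z).
        change (sq_chord t ^ S N) with (sq_chord t * sq_chord t ^ N).
        unfold Rdiv at 1; rewrite Rmult_assoc.
        unfold Rdiv in B at 1 2; split; [apply Rmult_le_pos; lra|nra].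
      + apply is_lim_seq_const.
      + apply is_lim_seq_geom; rewrite Rabs_right; lra. }
  rewrite <- (is_series_unique _ _ E).
  apply (is_derive_Series
    (fun k t => coef k * INR (S k) * (sq_chord t ^ k * (8 * sin t * cos t))) g
    (fun k => 10 * (2 / 3) ^ k) (- (7 / 10)) (7 / 10));
    [exact Ht | | | | apply ex_series_geom_23 |].
  - intros k y _.
    replace (g k y) with (coef k * INR (S k)
      * (sq_chord y ^ k * (8 * (2 * INR k + 1) - 4 * (INR k + 1) * sq_chord y))).
    + apply (is_derive_scal (fun t => sq_chord t ^ k * (8 * sin t * cos t))).
      apply sq_chord_pow_derive2.
    + unfold g, coef; rewrite S_INR; simpl (sq_chord y ^ S k).
      assert (R := cbinom_succ k); assert (P0 := pos_INR k).
      assert (P1 := cbinom_pos k); assert (P2 := cbinom_pos (S k)).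
      replace (cbinom k) with (cbinom (S k) * (INR k + 1) / (2 * (2 * INR k + 1)))
        by (rewrite R; field; lra).
      field; lra.
  - intros k y _; apply (ex_derive_continuous (V := R_NormedModule)).
    unfold g, sq_chord; auto_derive; trivial.
  - intros k y Hy; unfold g.
    assert (Z := sq_chord_bound y Hy).
    assert (B : forall j, 0 <= sq_chord y ^ j / cbinom j <= 3 / 2 * (2 / 3) ^ j).
    { intros [|j].
      - rewrite cbinom_0; simpl; lra.
      - assert (B := pow_cbinom_bound _ j Z).
        change (sq_chord y ^ S j) with (sq_chord y * sq_chord y ^ j).
        change ((2 / 3) ^ S j) with (2 / 3 * (2 / 3) ^ j).
        unfold Rdiv at 1; rewrite Rmult_assoc.
        unfold Rdiv in B at 1 2; split; [apply Rmult_le_pos; lra|].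
        unfold Rdiv at 1 3; nra. }
    assert (B1 := B k); assert (B2 := B (S k)).
    change ((2 / 3) ^ S k) with (2 / 3 * (2 / 3) ^ k) in B2.
    rewrite Rabs_mult, (Rabs_right 4) by lra.
    assert (Rabs (sq_chord y ^ k / cbinom k - sq_chord y ^ S k / cbinom (S k)) <= 5 / 2 * (2 / 3) ^ k);
      [apply Rabs_le|]; lra.
  - intros y Hy; apply ex_series_dom with (2 := ex_series_geom_23 4).
    intros k; apply arcsin_sq'_bound, Hy.
Qed.

Lemma arcsin_sq_eq (t : R) : 0 <= t < 7 / 10 -> arcsin_sq t = 2 * t ^ 2.
Proof.
  intros Ht.
  assert (C0 : sq_chord 0 = 0) by (unfold sq_chord; rewrite sin_0; ring).
  assert (E1 : forall y, 0 <= y < 7 / 10 -> arcsin_sq' y = 4 * y).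
  { intros y Hy; destruct (Req_dec y 0) as [->|N].
    - unfold arcsin_sq'; rewrite Series_zero; [ring|].
      intros n; rewrite sin_0; ring.
    - assert (E : arcsin_sq' 0 - 4 * 0 = arcsin_sq' y - 4 * y).
      { apply (eq_is_derive (V := R_NormedModule) (fun y => arcsin_sq' y - 4 * y)); [|lra].
        intros s Hs; change (is_derive (fun y => arcsin_sq' y - 4 * y) s 0).
        replace 0 with (4 - 4) by ring.
        apply (is_derive_minus (K := R_AbsRing) (V := R_NormedModule)).
        - apply arcsin_sq'_derive; lra.
        - auto_derive; [trivial|ring]. }
      unfold arcsin_sq' at 1 in E; rewrite Series_zero in E; [lra|].
      intros n; rewrite sin_0; ring. }
  destruct (Req_dec t 0) as [->|N].
  - unfold arcsin_sq; rewrite Series_zero; [ring|].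
    intros n; rewrite C0; simpl; ring.
  - assert (E : arcsin_sq 0 - 2 * 0 ^ 2 = arcsin_sq t - 2 * t ^ 2).
    { apply (eq_is_derive (V := R_NormedModule) (fun y => arcsin_sq y - 2 * y ^ 2)); [|lra].
      intros s Hs; change (is_derive (fun y => arcsin_sq y - 2 * y ^ 2) s 0).
      replace 0 with (arcsin_sq' s - 4 * s) by (rewrite E1; lra).
      apply (is_derive_minus (K := R_AbsRing) (V := R_NormedModule)).
      - apply arcsin_sq_derive; lra.
      - auto_derive; [trivial|ring]. }
    unfold arcsin_sq at 1 in E; rewrite Series_zero in E; [lra|].
    intros n; rewrite C0; simpl; ring.
Qed.

(** * Harmonic numbers and the log-sine integral *)

(** The primitive vanishing at 0 of [(1 - w^(2k)) (1 + 35 w) / (1 - w^2)], which is the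
    polynomial [harm_poly' k].  The odd powers contribute the odd part of [S1 (2k)] and the
    even ones 35 halves of [S1 k], that is the even part of [S1 (2k)] and [17 S1 k]. *)
Fixpoint harm_poly (k : nat) (w : R) : R :=
  match k with
  | O => 0
  | S j => harm_poly j w + (w * (w ^ 2) ^ j / (2 * INR j + 1)
                     + 35 * (w ^ 2) ^ S j / (2 * (INR j + 1)))
  end.

Fixpoint harm_poly' (k : nat) (w : R) : R :=
  match k with
  | O => 0
  | S j => harm_poly' j w + (w ^ 2) ^ j * (1 + 35 * w)
  end.

Lemma S1_succ (n : nat) : S1 (S n) = S1 n + / INR (S n).
Proof.
  unfold S1; rewrite sum_n_Sm by lia; R_ops; unfold Rdiv; ring.
Qed.

Lemma S1_0 : S1 0 = 0.
Proof. apply (sum_n_m_zero (G := R_AbelianMonoid)); lia. Qed.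

Lemma harm_poly_1 (k : nat) : harm_poly k 1 = S1 (2 * k) + 17 * S1 k.
Proof.
  induction k as [|k IH].
  - change (0 = S1 0 + 17 * S1 0); rewrite S1_0; ring.
  - simpl harm_poly; rewrite IH.
    replace (2 * S k)%nat with (S (S (2 * k))) by lia.
    rewrite !S1_succ, !S_INR, mult_INR; change (INR 2) with 2.
    replace (1 * (1 * 1)) with 1 by ring; rewrite pow1.
    assert (P := pos_INR k); field; lra.
Qed.

Lemma harm_poly_0 (k : nat) : harm_poly k 0 = 0.
Proof.
  induction k as [|k IH]; [reflexivity|].
  simpl; rewrite IH; unfold Rdiv; ring.
Qed.

Lemma harm_poly'_eq (k : nat) (w : R) : (1 - w ^ 2) * harm_poly' k w = (1 - (w ^ 2) ^ k) * (1 + 35 * w).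
Proof.
  induction k as [|k IH]; [simpl; ring|].
  change (harm_poly' (S k) w) with (harm_poly' k w + (w ^ 2) ^ k * (1 + 35 * w)).
  change ((w ^ 2) ^ S k) with (w ^ 2 * (w ^ 2) ^ k).
  rewrite Rmult_plus_distr_l, IH; ring.
Qed.

Lemma harm_poly_derive (k : nat) (w : R) : is_derive (harm_poly k) w (harm_poly' k w).
Proof.
  induction k as [|k IH].
  - apply (is_derive_const (K := R_AbsRing) (V := R_NormedModule) 0).
  - apply (is_derive_plus (K := R_AbsRing) (V := R_NormedModule) (harm_poly k)); [exact IH|].
    replace ((w ^ 2) ^ k * (1 + 35 * w)) with
      ((w ^ 2) ^ k + 35 * (w * (w ^ 2) ^ k)) by ring.
    apply (is_derive_ext (fun t => t ^ S (2 * k) / (2 * INR k + 1)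
      + 35 * t ^ S (S (2 * k)) / (2 * (INR k + 1)))).
    + intros t; change ((t ^ 2) ^ S k) with (t ^ 2 * (t ^ 2) ^ k).
      rewrite <- pow_mult; change (t ^ S (S (2 * k))) with (t * (t * t ^ (2 * k))).
      change (t ^ S (2 * k)) with (t * t ^ (2 * k)).
      R_ops; unfold Rdiv; ring.
    + apply (is_derive_ext (fun t => / (2 * INR k + 1) * t ^ S (2 * k)
        + 35 / (2 * (INR k + 1)) * t ^ S (S (2 * k)))).
      { intros t; unfold Rdiv; R_ops; ring. }
      assert (P := pos_INR k).
      assert (D : forall n, is_derive (fun t => t ^ S n) w (INR (S n) * 1 * w ^ n))
        by (intros n; apply (is_derive_pow (fun t => t) (S n) w 1), (is_derive_id (K := R_AbsRing))).
      replace ((w ^ 2) ^ k + 35 * (w * (w ^ 2) ^ k)) with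
        (/ (2 * INR k + 1) * (INR (S (2 * k)) * 1 * w ^ (2 * k))
         + 35 / (2 * (INR k + 1)) * (INR (S (S (2 * k))) * 1 * w ^ S (2 * k))).
      * apply (is_derive_plus (K := R_AbsRing) (V := R_NormedModule));
          apply (is_derive_scal (fun t => t ^ S _)), D.
      * rewrite !S_INR, mult_INR; change (INR 2) with 2.
        change (w ^ S (2 * k)) with (w * w ^ (2 * k)).
        rewrite <- !pow_mult; field; lra.
Qed.

Lemma harm_poly_bounds (k : nat) (w : R) : - (7 / 5) < w < 7 / 5 ->
  Rabs (harm_poly k w) <= INR k * (75 * 2 ^ k) /\ Rabs (harm_poly' k w) <= INR k * (75 * 2 ^ k).
Proof.
  intros Hw.
  induction k as [|k [IH1 IH2]]; [simpl; rewrite Rabs_R0; lra|].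
  assert (P := pos_INR k).
  assert (Z : 0 <= w ^ 2 <= 2) by nra.
  assert (Zk : 0 <= (w ^ 2) ^ k <= 2 ^ k)
    by (split; [apply pow_le | apply pow_incr]; lra).
  assert (P2 : 0 < 2 ^ k) by (apply pow_lt; lra).
  rewrite S_INR; change (2 ^ S k) with (2 * 2 ^ k).
  assert (G : forall a b, Rabs a <= INR k * (75 * 2 ^ k) -> Rabs b <= 75 * 2 ^ k ->
    Rabs (a + b) <= (INR k + 1) * (75 * (2 * 2 ^ k))).
  { intros a b Ha Hb; eapply Rle_trans; [apply Rabs_triang|].
    assert (0 <= INR k * 2 ^ k) by (apply Rmult_le_pos; lra); lra. }
  split; apply G; [exact IH1 | | exact IH2 |].
  - change ((w ^ 2) ^ S k) with (w ^ 2 * (w ^ 2) ^ k).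
    replace (w * (w ^ 2) ^ k / (2 * INR k + 1) + 35 * (w ^ 2 * (w ^ 2) ^ k) / (2 * (INR k + 1)))
      with ((w / (2 * INR k + 1) + 35 * w ^ 2 / (2 * (INR k + 1))) * (w ^ 2) ^ k)
      by (field; lra).
    rewrite Rabs_mult, (Rabs_right ((w ^ 2) ^ k)) by lra.
    apply Rmult_le_compat; [apply Rabs_pos | lra | | lra].
    eapply Rle_trans; [apply Rabs_triang|].
    assert (I : forall c d, 1 <= d -> Rabs (c / d) <= Rabs c).
    { intros c d Hd; apply Rabs_mult_le_1.
      rewrite Rabs_right by (apply Rle_ge; left; apply Rinv_0_lt_compat; lra).
      rewrite <- Rinv_1; apply Rinv_le_contravar; lra. }
    assert (Rabs w <= 7 / 5) by (apply Rabs_le; lra).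
    assert (Rabs (35 * w ^ 2) <= 70) by (apply Rabs_le; lra).
    generalize (I w (2 * INR k + 1)) (I (35 * w ^ 2) (2 * (INR k + 1))); lra.
  - rewrite Rabs_mult, (Rabs_right ((w ^ 2) ^ k)), Rmult_comm by lra.
    apply Rmult_le_compat; [apply Rabs_pos | lra | | lra].
    apply Rabs_le; lra.
Qed.

Definition harm_series (w : R) : R := Series (fun k => coef k * harm_poly (S k) w).

Lemma coef_poly_bound (k : nat) (x : R) : Rabs x <= INR (S k) * (75 * 2 ^ S k) ->
  Rabs (coef k * x) <= 75 * (2 / 3) ^ k.
Proof.
  intros H; assert (B := coef_S_bound k); assert (B0 := coef_pos k).
  assert (B2 := pow_cbinom_bound 2 k ltac:(lra)).
  rewrite Rabs_mult, (Rabs_right (coef k)) by lra.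
  apply Rle_trans with (coef k * (INR (S k) * (75 * 2 ^ S k)));
    [apply Rmult_le_compat_l; lra|].
  rewrite <- Rmult_assoc; change (2 ^ S k) with (2 * 2 ^ k).
  assert (P2 : 0 < 2 ^ k) by (apply pow_lt; lra).
  apply Rle_trans with (/ cbinom (S k) * (75 * (2 * 2 ^ k)));
    [apply Rmult_le_compat_r; lra|].
  unfold Rdiv in B2 at 1; lra.
Qed.

Lemma harm_series_ex (w : R) : - (7 / 5) < w < 7 / 5 -> ex_series (fun k => coef k * harm_poly (S k) w).
Proof.
  intros Hw; apply ex_series_dom with (2 := ex_series_geom_23 75).
  intros k; apply coef_poly_bound, harm_poly_bounds, Hw.
Qed.

Lemma harm_poly'_continuous (k : nat) (w : R) : continuous (harm_poly' k) w.
Proof.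
  induction k as [|k IH]; [apply continuous_const|].
  apply (continuous_plus (K := R_AbsRing) (V := R_NormedModule) (harm_poly' k)); [exact IH|].
  apply (ex_derive_continuous (V := R_NormedModule)); auto_derive; trivial.
Qed.

Lemma harm_series_derive (w : R) : - (7 / 5) < w < 7 / 5 ->
  is_derive harm_series w (Series (fun k => coef k * harm_poly' (S k) w)).
Proof.
  intros Hw.
  apply (is_derive_Series (fun k w => coef k * harm_poly (S k) w) (fun k w => coef k * harm_poly' (S k) w)
    (fun k => 75 * (2 / 3) ^ k) (- (7 / 5)) (7 / 5));
    [exact Hw | | | | apply ex_series_geom_23 | exact harm_series_ex].
  - intros k y _; apply (is_derive_scal (harm_poly (S k))), harm_poly_derive.
  - intros k y _.
    apply (continuous_scal_r (K := R_AbsRing) (V := R_NormedModule) (coef k)).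
    apply harm_poly'_continuous.
  - intros k y Hy; apply coef_poly_bound, harm_poly_bounds, Hy.
Qed.

(** The second bound holds since the slope of [2 sin] is at least 1 up to [PI / 6].  It
    compares the factor [PI / 6 - t] of the boundary term with the argument of the
    singular logarithm. *)
Lemma sin_below_PI6 (t : R) : 0 <= t <= PI / 6 ->
  0 <= 2 * sin t /\ PI / 6 - t <= 1 - 2 * sin t.
Proof.
  intros Ht; assert (P := PI_RGT_0).
  split; [generalize (sin_ge_0 t); lra|].
  destruct (Req_dec t (PI / 6)) as [->|N]; [rewrite sin_PI6; lra|].
  destruct (MVT_gen sin t (PI / 6) cos) as [c [Hc E]].
  - intros; auto_derive; [trivial|ring].
  - intros; apply continuity_sin.
  - rewrite Rmin_left, Rmax_right in Hc by lra.
    rewrite sin_PI6 in E.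
    assert (C : cos (PI / 3) <= cos c) by (apply cos_decr_1; lra).
    rewrite cos_PI3 in C; nra.
Qed.

Lemma PI6_lt : PI / 6 < 7 / 10.
Proof. generalize PI_4; lra. Qed.

Lemma harm_series_derive_eq (t : R) : 0 <= t < PI / 6 ->
  Series (fun k => coef k * harm_poly' (S k) (2 * sin t))
  = (2 * (PI / 6) ^ 2 - 2 * t ^ 2) * (1 + 35 * (2 * sin t)) / (1 - (2 * sin t) ^ 2).
Proof.
  intros Ht; generalize PI6_lt PI_RGT_0; intros P4 P.
  destruct (sin_below_PI6 t) as [S0 S1]; [lra|].
  rewrite <- (arcsin_sq_eq (PI / 6)), <- (arcsin_sq_eq t) by lra.
  unfold arcsin_sq; rewrite <- Series_minus by (apply arcsin_sq_ex; lra).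
  unfold Rdiv at 1; rewrite Rmult_assoc, <- Series_scal_r.
  apply Series_ext; intros k.
  assert (C1 : sq_chord (PI / 6) = 1) by (unfold sq_chord; rewrite sin_PI6; field).
  assert (Ct : sq_chord t = (2 * sin t) ^ 2) by (unfold sq_chord; ring).
  rewrite C1, Ct, pow1.
  assert (D : 1 - (2 * sin t) ^ 2 <> 0) by nra.
  apply Rmult_eq_reg_l with (1 - (2 * sin t) ^ 2); [|exact D].
  transitivity (coef k * ((1 - (2 * sin t) ^ 2) * harm_poly' (S k) (2 * sin t))); [ring|].
  rewrite harm_poly'_eq; field; exact D.
Qed.

(** Since [C3' = - C2], the [C2] terms of the product rule cancel. *)
Lemma logsin_minus_derive (b t : R) : 0 < b - t < PI ->
  is_derive (fun t => t * Fsin 1 2 (b - t) - Fcos 1 3 (b - t)) t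
    (t * ln (2 * sin ((b - t) / 2))).
Proof.
  intros H.
  assert (D2 := Fsin_2_derive (b - t) H).
  assert (D3 := Fcos_derive 1 2 (b - t) (summable_1 2 ltac:(lia))).
  assert (U2 : Derive (fun x => Fsin 1 2 x) (b + - t) = _) by exact (is_derive_unique _ _ _ D2).
  assert (U3 : Derive (fun x => Fcos 1 3 x) (b + - t) = _) by exact (is_derive_unique _ _ _ D3).
  auto_derive.
  - split; [eexists; exact D2|split; [eexists; exact D3|trivial]].
  - rewrite U2, U3; change (b + - t) with (b - t); ring.
Qed.

Lemma logsin_plus_derive (b t : R) : 0 < b + t < PI ->
  is_derive (fun t => t * Fsin 1 2 (b + t) + Fcos 1 3 (b + t)) t
    (- (t * ln (2 * sin ((b + t) / 2)))).
Proof.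
  intros H.
  assert (D2 := Fsin_2_derive (b + t) H).
  assert (D3 := Fcos_derive 1 2 (b + t) (summable_1 2 ltac:(lia))).
  assert (U2 : Derive (fun x => Fsin 1 2 x) (b + t) = _) by exact (is_derive_unique _ _ _ D2).
  assert (U3 : Derive (fun x => Fcos 1 3 x) (b + t) = _) by exact (is_derive_unique _ _ _ D3).
  auto_derive.
  - split; [eexists; exact D2|split; [eexists; exact D3|trivial]].
  - rewrite U2, U3; ring.
Qed.

Definition logsin_minus (b t : R) : R := t * Fsin 1 2 (b - t) - Fcos 1 3 (b - t).
Definition logsin_plus (b t : R) : R := t * Fsin 1 2 (b + t) + Fcos 1 3 (b + t).
(** A primitive of [t * log_kernel t].  The weights 18 and 17 are those of the partial
    fractions [(1 + 35 w) / (1 - w^2) = 18 / (1 - w) - 17 / (1 + w)]. *)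
Definition logsin_prim (t : R) : R :=
  18 * (logsin_minus (5 * (PI / 6)) t + logsin_minus (PI / 6) t) - 17 * (logsin_plus (PI / 6) t + logsin_plus (5 * (PI / 6)) t).
Definition log_kernel (t : R) : R := 18 * ln (1 - 2 * sin t) + 17 * ln (1 + 2 * sin t).

Lemma ln_sin_prod (x y : R) : 0 < sin x -> 0 < sin y ->
  ln (2 * sin x) + ln (2 * sin y) = ln (2 * (cos (x - y) - cos (x + y))).
Proof.
  intros Hx Hy; rewrite <- ln_mult by lra; f_equal.
  rewrite cos_minus, cos_plus; ring.
Qed.

Lemma logsin_prim_derive (t : R) : 0 <= t < PI / 6 -> is_derive logsin_prim t (t * log_kernel t).
Proof.
  intros Ht; assert (P := PI_RGT_0).
  replace (t * log_kernel t) with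
    (18 * (t * ln (2 * sin ((5 * (PI / 6) - t) / 2)) + t * ln (2 * sin ((PI / 6 - t) / 2)))
     - 17 * (- (t * ln (2 * sin ((PI / 6 + t) / 2)))
             + - (t * ln (2 * sin ((5 * (PI / 6) + t) / 2))))).
  - apply (is_derive_minus (K := R_AbsRing) (V := R_NormedModule));
      apply (is_derive_scal (fun t => _ + _));
      apply (is_derive_plus (K := R_AbsRing) (V := R_NormedModule));
      (apply logsin_minus_derive || apply logsin_plus_derive); lra.
  - assert (E1 : ln (1 - 2 * sin t) =
      ln (2 * sin ((5 * (PI / 6) - t) / 2)) + ln (2 * sin ((PI / 6 - t) / 2))).
    { rewrite ln_sin_prod by (apply sin_gt_0; lra); f_equal.
      replace ((5 * (PI / 6) - t) / 2 - (PI / 6 - t) / 2) with (PI / 3) by field.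
      replace ((5 * (PI / 6) - t) / 2 + (PI / 6 - t) / 2) with (PI / 2 - t) by field.
      rewrite cos_PI3, cos_shift; field. }
    assert (E2 : ln (1 + 2 * sin t) =
      ln (2 * sin ((5 * (PI / 6) + t) / 2)) + ln (2 * sin ((PI / 6 + t) / 2))).
    { rewrite ln_sin_prod by (apply sin_gt_0; lra); f_equal.
      replace ((5 * (PI / 6) + t) / 2 - (PI / 6 + t) / 2) with (PI / 3) by field.
      replace ((5 * (PI / 6) + t) / 2 + (PI / 6 + t) / 2) with (PI / 2 - - t) by field.
      rewrite cos_PI3, cos_shift, sin_neg; field. }
    unfold log_kernel; rewrite E1, E2; ring.
Qed.

(** Integration by parts without integrals: the derivative of [harm_series (2 sin t)]
    cancels against that of the logarithms, and [4 logsin_prim] compensates the derivative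
    of [- 2 t^2]. *)
Definition conserved (t : R) : R :=
  harm_series (2 * sin t) + (2 * (PI / 6) ^ 2 - 2 * t ^ 2) * log_kernel t + 4 * logsin_prim t.

Lemma conserved_const (t : R) : 0 <= t < PI / 6 -> conserved t = conserved 0.
Proof.
  intros Ht; destruct (Req_dec t 0) as [->|N]; [reflexivity|symmetry].
  apply (eq_is_derive (V := R_NormedModule)); [|lra].
  intros s Hs; change (is_derive conserved s 0).
  destruct (sin_below_PI6 s) as [S0 S1]; [lra|].
  assert (Hw : - (7 / 5) < 2 * sin s < 7 / 5) by lra.
  assert (D1 := harm_series_derive (2 * sin s) Hw).
  rewrite (harm_series_derive_eq s) in D1 by lra.
  assert (D2 := logsin_prim_derive s ltac:(lra)).
  assert (U1 : Derive (fun x => harm_series x) (2 * sin s) = _) by exact (is_derive_unique _ _ _ D1).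
  assert (U2 : Derive (fun x => logsin_prim x) s = _) by exact (is_derive_unique _ _ _ D2).
  assert (X : 1 - (2 * sin s) ^ 2 <> 0) by nra.
  unfold conserved, log_kernel; auto_derive.
  - repeat split; try lra; [eexists; exact D1 | eexists; exact D2].
  - rewrite U1, U2; unfold log_kernel; change (1 + - (2 * sin s)) with (1 - 2 * sin s); field; repeat split; nra.
Qed.

Lemma mul_ln_bound (z : R) : 0 < z <= 1 -> z * Rabs (ln z) <= 2 * sqrt z.
Proof.
  intros Hz; assert (Q := sqrt_lt_R0 z (proj1 Hz)).
  assert (QQ : sqrt z * sqrt z = z) by (apply sqrt_sqrt; lra).
  assert (L : - ln (sqrt z) <= / sqrt z).
  { rewrite <- ln_Rinv by exact Q.
    assert (IQ := Rinv_0_lt_compat _ Q).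
    generalize (exp_ineq1_le (ln (/ sqrt z))); rewrite exp_ln by exact IQ; lra. }
  assert (L0 : ln z <= 0) by (rewrite <- ln_1; apply ln_le; lra).
  rewrite Rabs_left1 by exact L0.
  rewrite <- QQ at 1 2; rewrite ln_mult by exact Q.
  replace (2 * sqrt z) with (sqrt z * sqrt z * (2 * / sqrt z)) by (field; lra).
  apply Rmult_le_compat_l; nra.
Qed.

(** At [PI / 6] the factor in front of the logarithm vanishes to first order, and [z ln z]
    is at most of the order of the square root of [z]. *)
Lemma boundary_bound (t : R) : 0 <= t < PI / 6 ->
  Rabs ((2 * (PI / 6) ^ 2 - 2 * t ^ 2) * log_kernel t)
    <= 144 * sqrt (1 - 2 * sin t) + 68 * (1 - 2 * sin t).
Proof.
  intros Ht; destruct (sin_below_PI6 t) as [S0 S1]; [lra|].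
  generalize PI6_lt; intros P4.
  set (z := 1 - 2 * sin t) in *.
  assert (Z' : 2 * sin t < 1) by (unfold z in *; lra).
  assert (Z : 0 < z <= 1) by (unfold z in *; lra).
  assert (M := mul_ln_bound z Z).
  assert (N := Rabs_pos (ln z)).
  assert (L : Rabs (ln (1 + 2 * sin t)) <= 1).
  { assert (0 <= ln (1 + 2 * sin t)) by (rewrite <- ln_1; apply ln_le; lra).
    rewrite Rabs_right by lra.
    generalize (exp_ineq1_le (ln (1 + 2 * sin t))); rewrite exp_ln by lra; lra. }
  replace (2 * (PI / 6) ^ 2 - 2 * t ^ 2) with (2 * (PI / 6 + t) * (PI / 6 - t)) by ring.
  rewrite Rabs_mult.
  rewrite (Rabs_right (2 * (PI / 6 + t) * (PI / 6 - t)))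
    by (apply Rle_ge, Rmult_le_pos; lra).
  assert (EL : Rabs (log_kernel t) <= 18 * Rabs (ln z) + 17).
  { unfold log_kernel; fold z; eapply Rle_trans; [apply Rabs_triang|].
    rewrite !Rabs_mult, (Rabs_right 18), (Rabs_right 17) by lra; lra. }
  apply Rle_trans with (4 * z * (18 * Rabs (ln z) + 17)).
  - apply Rmult_le_compat; [apply Rmult_le_pos; lra | apply Rabs_pos | | exact EL].
    apply Rmult_le_compat; lra.
  - nra.
Qed.

Lemma logsin_prim_continuous (t : R) : continuous logsin_prim t.
Proof.
  assert (Cm : forall b, continuous (fun t => b - t) t).
  { intros b; apply (ex_derive_continuous (V := R_NormedModule)); auto_derive; trivial. }
  assert (Cp : forall b, continuous (fun t => b + t) t).
  { intros b; apply (ex_derive_continuous (V := R_NormedModule)); auto_derive; trivial. }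
  assert (Hm : forall b, continuous (logsin_minus b) t).
  { intros b; apply (continuous_minus (K := R_AbsRing) (V := R_NormedModule)).
    - apply (continuous_mult (K := R_AbsRing)); [apply continuous_id|].
      apply (continuous_comp (fun t => b - t)); [apply Cm | apply Fsin_continuous; lia].
    - apply (continuous_comp (fun t => b - t)); [apply Cm | apply Fcos_continuous; lia]. }
  assert (Hp : forall b, continuous (logsin_plus b) t).
  { intros b; apply (continuous_plus (K := R_AbsRing) (V := R_NormedModule)).
    - apply (continuous_mult (K := R_AbsRing)); [apply continuous_id|].
      apply (continuous_comp (fun t => b + t)); [apply Cp | apply Fsin_continuous; lia].
    - apply (continuous_comp (fun t => b + t)); [apply Cp | apply Fcos_continuous; lia]. }
  apply (continuous_minus (K := R_AbsRing) (V := R_NormedModule));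
    apply (continuous_scal_r (K := R_AbsRing) (V := R_NormedModule));
    apply (continuous_plus (K := R_AbsRing) (V := R_NormedModule)); auto.
Qed.

Lemma harm_series_1 : harm_series 1 = conserved 0 - 4 * logsin_prim (PI / 6).
Proof.
  assert (P := PI_RGT_0).
  set (u := fun n => PI / 6 * (1 - / INR (S n))).
  assert (Hu : forall n, 0 <= u n < PI / 6).
  { intros n; unfold u; assert (I := inv_S_pos n).
    assert (I1 : / INR (S n) <= 1).
    { rewrite <- Rinv_1; apply Rinv_le_contravar; [lra|apply (le_INR 1); lia]. }
    split; nra. }
  assert (Lu : is_lim_seq u (PI / 6)).
  { replace (Finite (PI / 6)) with (Finite (PI / 6 * (1 - 0))) by (f_equal; ring).
    apply is_lim_seq_mult'; [apply is_lim_seq_const|].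
    apply is_lim_seq_minus'; [apply is_lim_seq_const|exact inv_S_lim]. }
  assert (Cs : continuous (fun t => 2 * sin t) (PI / 6)).
  { apply (ex_derive_continuous (V := R_NormedModule)); auto_derive; trivial. }
  assert (L : forall f, continuous f (PI / 6) -> is_lim_seq (fun n => f (u n)) (f (PI / 6))).
  { intros f Hf; apply is_lim_seq_continuous; [apply continuity_pt_filterlim, Hf|exact Lu]. }
  assert (S6 : 2 * sin (PI / 6) = 1) by (rewrite sin_PI6; field).
  assert (L1 : is_lim_seq (fun n => harm_series (2 * sin (u n))) (harm_series 1)).
  { rewrite <- S6; apply (L (fun t => harm_series (2 * sin t))).
    apply (continuous_comp (fun t => 2 * sin t) harm_series); [exact Cs|].
    eapply continuous_of_is_derive, harm_series_derive; rewrite S6; lra. }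
  assert (L2 : is_lim_seq (fun n => 4 * logsin_prim (u n)) (4 * logsin_prim (PI / 6))).
  { apply is_lim_seq_mult'; [apply is_lim_seq_const|apply L, logsin_prim_continuous]. }
  assert (L3 : is_lim_seq (fun n => (2 * (PI / 6) ^ 2 - 2 * u n ^ 2) * log_kernel (u n)) 0).
  { apply is_lim_seq_abs_0.
    apply (is_lim_seq_le_le (fun _ => 0) _
      (fun n => 144 * sqrt (1 - 2 * sin (u n)) + 68 * (1 - 2 * sin (u n)))).
    - intros n; split; [apply Rabs_pos | apply boundary_bound, Hu].
    - apply is_lim_seq_const.
    - assert (LZ : is_lim_seq (fun n => 1 - 2 * sin (u n)) 0).
      { replace 0 with (1 - 2 * sin (PI / 6)) by lra.
        apply is_lim_seq_minus'; [apply is_lim_seq_const|exact (L (fun t => 2 * sin t) Cs)]. }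
      replace (Finite 0) with (Finite (144 * sqrt 0 + 68 * 0))
        by (f_equal; rewrite sqrt_0; ring).
      apply is_lim_seq_plus'; apply is_lim_seq_mult'; try apply is_lim_seq_const; [|exact LZ].
      apply (is_lim_seq_continuous sqrt); [|exact LZ].
      apply continuity_pt_filterlim, continuous_sqrt. }
  assert (LH : is_lim_seq (fun n => conserved (u n)) (harm_series 1 + 0 + 4 * logsin_prim (PI / 6))).
  { apply is_lim_seq_plus'; [apply is_lim_seq_plus'|]; assumption. }
  assert (LC : is_lim_seq (fun n => conserved (u n)) (conserved 0)).
  { apply (is_lim_seq_ext (fun _ => conserved 0)); [|apply is_lim_seq_const].
    intros n; symmetry; apply conserved_const, Hu. }
  apply is_lim_seq_unique in LH; apply is_lim_seq_unique in LC.
  rewrite LH in LC; injection LC; lra.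
Qed.

(** The [C3] values cancel, and the [C2] values combine to
    [4 a (17 C2 (PI/3) - 18 C2 (2 PI/3)) = 5 PI C2 (2 PI/3)]. *)
Lemma harm_series_1_value : harm_series 1 = 5 / 2 * sqrt 3 * PI * K.
Proof.
  assert (T2 := Fsin_2_third); assert (T3 := Fcos_3_third).
  assert (d0 := Fcos_dup 3 0 ltac:(lia)).
  assert (d3 := Fcos_dup 3 (PI / 3) ltac:(lia)).
  assert (d6 := Fcos_dup 3 (PI / 6) ltac:(lia)).
  assert (s3 := Fsin_dup 2 (PI / 3) ltac:(lia)).
  assert (sp := Fsin_PI 1 2).
  rewrite Rmult_0_r, Rminus_0_r in d0.
  replace (PI - PI / 3) with (2 * (PI / 3)) in d3, s3 by field.
  replace (PI - PI / 6) with (5 * (PI / 6)) in d6 by field.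
  replace (2 * (PI / 6)) with (PI / 3) in d6 by field.
  assert (g0 : harm_series 0 = 0).
  { apply Series_zero; intros n; rewrite harm_poly_0; ring. }
  rewrite harm_series_1; unfold conserved, log_kernel, logsin_prim, logsin_minus, logsin_plus.
  rewrite sin_0, Rmult_0_r, g0, Rminus_0_r, Rplus_0_r, ln_1, !Rminus_0_r, !Rplus_0_r.
  replace (5 * (PI / 6) - PI / 6) with (2 * (PI / 3)) by field.
  replace (PI / 6 - PI / 6) with 0 by ring.
  replace (PI / 6 + PI / 6) with (PI / 3) by field.
  replace (5 * (PI / 6) + PI / 6) with PI by field.
  assert (z0 : Fsin 1 2 0 = 0).
  { apply Series_zero; intros n; rewrite Rmult_0_r, sin_0; ring. }
  rewrite sp, z0.
  assert (e1 : Fsin 1 2 (PI / 3) = 3 / 2 * Fsin 1 2 (2 * (PI / 3))) by lra.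
  rewrite e1, T2.
  assert (c3 : Fcos 1 3 (PI / 3) = 1 / 3 * Fcos 1 3 0) by lra.
  assert (cp : Fcos 1 3 PI = - (3 / 4) * Fcos 1 3 0) by lra.
  assert (c5 : Fcos 1 3 (5 * (PI / 6)) = 1 / 12 * Fcos 1 3 0 - Fcos 1 3 (PI / 6)) by lra.
  rewrite c3, cp, c5, T3; field.
Qed.

Theorem mainTheorem8 :
  is_series (fun k : nat => summand (S k)) (5 / 2 * sqrt 3 * PI * K).
Proof.
  rewrite <- harm_series_1_value.
  apply (is_series_ext (fun k => coef k * harm_poly (S k) 1)).
  - intros k; rewrite harm_poly_1; unfold summand, coef, cbinom, Rdiv; R_ops; ring.
  - apply Series_correct, harm_series_ex; lra.
Qed.
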